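(* Let $g$ satisfy (G1) and (G2), and let $\beta:=\max_{\pi\in[0,1]}|(\mathcal{A}g)(\pi)|$. The functions $K\mapsto A^*(K)$ and $K\mapsto B^*(K)$ are continuously differentiable on $(\beta^{-1},\infty)$ with $$\frac{d}{dK}A^*(K)=\frac{2}{K^2}\,\frac{\Psi(B^*(K))-\Psi(A^*(K))-\Psi'(A^*(K))\,(B^*(K)-A^*(K))}{\left[g''(A^*(K))-2K^{-1}\Psi''(A^*(K))\right](B^*(K)-A^*(K))},$$ $$\frac{d}{dK}B^*(K)=\frac{2}{K^2}\,\frac{\Psi(B^*(K))-\Psi(A^*(K))-\Psi'(B^*(K))\,(B^*(K)-A^*(K))}{\left[g''(B^*(K))-2K^{-1}\Psi''(B^*(K))\right](B^*(K)-A^*(K))}.$$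
   Context: For $f\in C^2(0,1)$, $(\mathcal{A}f)(\pi):=\tfrac12\pi^2(1-\pi)^2f''(\pi)$. The function $g:[0,1]\to\mathbb{R}$ satisfies: (G1) $g\in C^2(0,1)$ is concave and $g(0)=g(1)=0$; (G2) there exists $\pi_0\in(0,1)$ such that $\mathcal{A}g$ is strictly decreasing on $(0,\pi_0)$ and strictly increasing on $(\pi_0,1)$. The limits of $\mathcal{A}g$ at $0$ and $1$ are $0$, so $\mathcal{A}g$ is extended by $0$ to $\{0,1\}$, and $\beta=|(\mathcal{A}g)(\pi_0)|>0$. The function $g$ is fixed and $K$ is a positive parameter. For $\pi\in(0,1)$, $\Psi(\pi):=(1-2\pi)\log\left(\frac{\pi}{1-\pi}\right)$ and $H(\pi;K):=g(\pi)-2K^{-1}\Psi(\pi)$; $H'$ denotes the derivative in $\pi$. For $K>\beta^{-1}$ the set $\{\pi\in(0,1):(\mathcal{A}g)(\pi)<-K^{-1}\}$ is a nonempty open interval with endpoints $0<\pi_*(K)<\pi^*(K)<1$, and $(A^*(K),B^*(K))$ denotes the unique pair $(A,B)\in(0,1)^2$ with $A\le\pi_*(K)$, $B\ge\pi^*(K)$, satisfying $H(B;K)-H(A;K)=H'(A;K)(B-A)$ and $H'(A;K)=H'(B;K)$. *)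

(* Defs.v *)
From Stdlib Require Import Reals ClassicalEpsilon.
From Coquelicot Require Import Coquelicot.

Open Scope R_scope.

(* A function on [0,1] is represented by a total function R -> R; the
   definitions below only involve its values on [0,1] and its derivatives at
   points of the open interval (0,1). *)

(* For p = 0 and p = 1 the prefactor vanishes, so this total function is already
   the extension of A f by 0 to the endpoints, whatever the junk value of the
   second derivative there. *)
Definition opA (f : R -> R) (p : R) : R :=
  / 2 * p ^ 2 * (1 - p) ^ 2 * Derive_n f 2 p.

Definition C2_open01 (f : R -> R) : Prop :=
  forall p, 0 < p < 1 ->
    ex_derive f p /\ ex_derive (Derive f) p /\ continuous (Derive_n f 2) p.

Definition concave01 (f : R -> R) : Prop :=
  forall x y t, 0 <= x <= 1 -> 0 <= y <= 1 -> 0 <= t <= 1 ->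
    t * f x + (1 - t) * f y <= f (t * x + (1 - t) * y).

Definition G1 (g : R -> R) : Prop :=
  C2_open01 g /\ concave01 g /\ g 0 = 0 /\ g 1 = 0.

Definition G2 (g : R -> R) : Prop :=
  exists p0, 0 < p0 < 1 /\
    (forall x y, 0 < x -> x < y -> y < p0 -> opA g y < opA g x) /\
    (forall x y, p0 < x -> x < y -> y < 1 -> opA g x < opA g y).

Definition is_max (E : R -> Prop) (m : R) : Prop := E m /\ is_upper_bound E m.

(* The operator [epsilon] returns an element satisfying the predicate whenever
   there is one, and an unspecified element otherwise. *)
Definition beta (g : R -> R) : R :=
  epsilon (inhabits 0)
    (is_max (fun y => exists p, 0 <= p <= 1 /\ y = Rabs (opA g p))).

Definition Psi (p : R) : R := (1 - 2 * p) * ln (p / (1 - p)).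

Definition H (g : R -> R) (K p : R) : R := g p - 2 * / K * Psi p.

Definition sublevel (g : R -> R) (K p : R) : Prop :=
  0 < p < 1 /\ opA g p < - / K.

(* Left and right endpoints of the sublevel set, as infimum and supremum. *)
Definition pi_low (g : R -> R) (K : R) : R := real (Glb_Rbar (sublevel g K)).
Definition pi_up (g : R -> R) (K : R) : R := real (Lub_Rbar (sublevel g K)).

Definition tangency_pair (g : R -> R) (K : R) (AB : R * R) : Prop :=
  let (A, B) := AB in
  (0 < A < 1) /\ (0 < B < 1) /\
  A <= pi_low g K /\ pi_up g K <= B /\
  H g K B - H g K A = Derive (H g K) A * (B - A) /\
  Derive (H g K) A = Derive (H g K) B.

Definition ABstar (g : R -> R) (K : R) : R * R :=
  epsilon (inhabits (0, 0)) (unique (tangency_pair g K)).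

Definition Astar (g : R -> R) (K : R) : R := fst (ABstar g K).
Definition Bstar (g : R -> R) (K : R) : R := snd (ABstar g K).

(* Main.v *)
Require Import Defs.
From Stdlib Require Import Reals Ranalysis5 Lra ClassicalEpsilon Classical.
From Coquelicot Require Import Coquelicot.

Open Scope R_scope.

(** In the parameter kappa = 2 / K, H = g - kappa Psi and Psi'' = - 1 / (p^2 (1-p)^2), so H''
    has the sign of A g + 1 / K: H is convex, then concave, then convex, and (A, B) are the
    contact points of its unique double tangent, which lies below H on all of (0,1).
    Comparing the double tangents for two parameters at the four contact points sandwiches
    the increment of the common slope s between two multiples of the increment of kappa.
    This gives uniqueness, continuity of s, hence of A and B, and then
    ds / dkappa = - (Psi B - Psi A) / (B - A) without any implicit function theorem;
    differentiating H'(A) = s = H'(B) yields the derivatives of A and B. *)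

(** The inflection points move with kappa, so the comparison of two parameters uses only global
    facts: each line supports its own graph, and H is affine in kappa with coefficient - Psi.
    Evaluating one line at a contact point of the other leaves just values of Psi and the length of
    a mixed chord, from a left contact point of one parameter to a right contact point of the other.
    Two uniform bounds turn this into continuity of s. Psi is unbounded near 0 and 1, so the contact
    points must be kept away from the ends; their monotonicity in K does this. The chords must not
    shrink; they always contain the minimizer p0 of A g. Existence of the tangent rests on Psi
    tending to - infinity at both ends: since g >= 0, H blows up there and the outer branches carry
    all the slopes required. The same blow-up forces A g above any negative level at points
    arbitrarily close to 0 and to 1, so both inflection points exist. *)

(** * Convexity through monotone derivatives, continuity, difference quotients *)

Lemma mean_value (f df : R -> R) (a b : R) :
  a < b -> (forall x, a <= x <= b -> is_derive f x (df x)) ->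
  exists c, a < c < b /\ f b - f a = df c * (b - a).
Proof.
  intros Hab Hf.
  destruct (MVT_cor2 f df a b Hab) as [c [Hc Hi]].
  - intros c Hc. apply is_derive_Reals, Hf, Hc.
  - exists c. auto.
Qed.

Lemma derive_pos_increasing (f df : R -> R) (a b : R) :
  a < b -> (forall x, a <= x <= b -> is_derive f x (df x)) ->
  (forall x, a < x < b -> 0 < df x) -> f a < f b.
Proof.
  intros Hab Hf Hpos.
  destruct (mean_value f df a b Hab Hf) as [c [Hc He]].
  specialize (Hpos c Hc). nra.
Qed.

Lemma tangent_lt (f df : R -> R) (a b : R) :
  (forall x, a <= x <= b -> is_derive f x (df x)) ->
  (forall x y, a <= x -> x < y -> y <= b -> df x < df y) ->
  forall x y, a <= x <= b -> a <= y <= b -> x <> y ->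
  f x + df x * (y - x) < f y.
Proof.
  intros Hf Hm x y Hx Hy Hne.
  destruct (Rtotal_order x y) as [H|[H|H]]; [|contradiction|].
  - destruct (mean_value f df x y H) as [c [Hc He]].
    + intros z Hz. apply Hf. lra.
    + assert (df x < df c) by (apply Hm; lra). nra.
  - destruct (mean_value f df y x H) as [c [Hc He]].
    + intros z Hz. apply Hf. lra.
    + assert (df c < df x) by (apply Hm; lra). nra.
Qed.

Lemma chord_lt (f df : R -> R) (a b : R) :
  (forall x, a <= x <= b -> is_derive f x (df x)) ->
  (forall x y, a <= x -> x < y -> y <= b -> df x < df y) ->
  forall x, a < x < b ->
  (b - a) * f x < (b - x) * f a + (x - a) * f b.
Proof.
  intros Hf Hm x Hx.
  assert (Ha := tangent_lt f df a b Hf Hm x a).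
  assert (Hb := tangent_lt f df a b Hf Hm x b).
  assert (f x + df x * (a - x) < f a) by (apply Ha; lra).
  assert (f x + df x * (b - x) < f b) by (apply Hb; lra).
  nra.
Qed.

Lemma chord_gt (f df : R -> R) (a b : R) :
  (forall x, a <= x <= b -> is_derive f x (df x)) ->
  (forall x y, a <= x -> x < y -> y <= b -> df y < df x) ->
  forall x, a < x < b ->
  (b - x) * f a + (x - a) * f b < (b - a) * f x.
Proof.
  intros Hf Hm x Hx.
  enough ((b - a) * - f x < (b - x) * - f a + (x - a) * - f b) by lra.
  apply (chord_lt (fun z => - f z) (fun z => - df z)); [| |exact Hx].
  - intros z Hz. apply (is_derive_opp f), Hf, Hz.
  - intros y z Hy Hyz Hz. specialize (Hm y z Hy Hyz Hz). lra.
Qed.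

Lemma continuous_locally_lt (f : R -> R) (x c : R) :
  continuous f x -> f x < c -> locally x (fun y => f y < c).
Proof.
  intros Hf Hc. exact (Hf (fun z => z < c) (open_lt c (f x) Hc)).
Qed.

Lemma continuous_locally_gt (f : R -> R) (x c : R) :
  continuous f x -> c < f x -> locally x (fun y => c < f y).
Proof.
  intros Hf Hc. exact (Hf (fun z => c < z) (open_gt c (f x) Hc)).
Qed.

Lemma continuous_of_locally_lt_gt (f : R -> R) (x : R) :
  (forall c, c < f x -> locally x (fun y => c < f y)) ->
  (forall c, f x < c -> locally x (fun y => f y < c)) ->
  continuous f x.
Proof.
  intros Hl Hu. apply filterlim_locally. intros eps.
  assert (H1 := Hl (f x - eps)). assert (H2 := Hu (f x + eps)).
  destruct eps as [e He]. simpl in *.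
  generalize (filter_and (F := locally x) _ _ (H1 ltac:(lra)) (H2 ltac:(lra))).
  apply filter_imp. intros y [Hy1 Hy2].
  change (Rabs (f y - f x) < e). apply Rabs_def1; lra.
Qed.

(* Caratheodory's characterization of differentiability *)
Lemma is_derive_slope (f : R -> R) (x l : R) :
  is_derive f x l ->
  exists q : R -> R, continuous q x /\ q x = l /\
    forall y, f y - f x = q y * (y - x).
Proof.
  intros Hf.
  exists (fun y => if Req_EM_T y x then l else (f y - f x) / (y - x)).
  split; [|split].
  - apply filterlim_locally. intros eps.
    apply is_derive_Reals in Hf.
    destruct (Hf eps (cond_pos eps)) as [d Hd].
    exists d. intros y Hy.
    destruct (Req_EM_T x x) as [_|n]; [|now elim n].
    destruct (Req_EM_T y x) as [_|Hn].
    + apply ball_center.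
    + specialize (Hd (y - x) (Rminus_eq_contra _ _ Hn) Hy).
      now rewrite Rplus_minus in Hd.
  - destruct (Req_EM_T x x) as [_|n]; [reflexivity|now elim n].
  - intros y. destruct (Req_EM_T y x) as [->|Hn].
    + ring.
    + field. lra.
Qed.

(** Converse of [is_derive_slope]. The factorization is asked for only near x, because the equations
    of the contact points hold only for K above the threshold. *)
Lemma slope_is_derive (f q : R -> R) (x : R) :
  continuous q x -> locally x (fun y => f y - f x = q y * (y - x)) ->
  is_derive f x (q x).
Proof.
  intros Hq Hf. apply is_derive_Reals. intros eps Heps.
  assert (Hq' := proj1 (filterlim_locally (F := locally x) q (q x)) Hq
                   (mkposreal eps Heps)).
  destruct (filter_and _ _ Hq' Hf) as [d Hd].
  exists d. intros h Hh0 Hh.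
  assert (Hb : Rabs (x + h - x) < d) by now replace (x + h - x) with h by ring.
  destruct (Hd (x + h) Hb) as [Hqh He].
  rewrite He.
  replace (q (x + h) * (x + h - x) / h) with (q (x + h)) by (field; lra).
  exact Hqh.
Qed.

(** * The function Psi *)

Definition dPsi (p : R) : R :=
  -2 * ln (p / (1 - p)) + (1 - 2 * p) / (p * (1 - p)).

Lemma is_derive_Psi (p : R) : 0 < p < 1 -> is_derive Psi p (dPsi p).
Proof.
  intros Hp. unfold Psi, dPsi. auto_derive.
  - split; [lra|split; [|exact I]]. apply Rdiv_lt_0_compat; lra.
  - change (p * / (1 + - p)) with (p / (1 - p)) at 1. field. lra.
Qed.

(** Equivalently A Psi = - 1/2, which is why subtracting 2 / K times Psi shifts A g by the constant
    1 / K. *)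
Lemma is_derive_dPsi (p : R) :
  0 < p < 1 -> is_derive dPsi p (- / (p ^ 2 * (1 - p) ^ 2)).
Proof.
  intros Hp. unfold dPsi. auto_derive.
  - repeat split; try lra. apply Rdiv_lt_0_compat; lra. nra.
  - field. lra.
Qed.

Lemma locally_open01 (p : R) : 0 < p < 1 -> locally p (fun x => 0 < x < 1).
Proof.
  intros [H0 H1]. apply filter_and; [apply (open_gt 0 p H0)|apply (open_lt 1 p H1)].
Qed.

Lemma Derive_Psi (p : R) : 0 < p < 1 -> Derive Psi p = dPsi p.
Proof. intros Hp. now apply is_derive_unique, is_derive_Psi. Qed.

Lemma Derive2_Psi (p : R) :
  0 < p < 1 -> Derive_n Psi 2 p = - / (p ^ 2 * (1 - p) ^ 2).
Proof.
  intros Hp. apply is_derive_unique.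
  apply is_derive_ext_loc with dPsi.
  - generalize (locally_open01 p Hp). apply filter_imp.
    intros x Hx. symmetry. now apply Derive_Psi.
  - now apply is_derive_dPsi.
Qed.

Lemma weight_pos (p : R) : 0 < p < 1 -> 0 < p ^ 2 * (1 - p) ^ 2.
Proof.
  intros Hp. apply Rmult_lt_0_compat; apply pow_lt; lra.
Qed.

Lemma dPsi_decreasing (x y : R) : 0 < x -> x < y -> y < 1 -> dPsi y < dPsi x.
Proof.
  intros Hx Hxy Hy.
  enough (- dPsi x < - dPsi y) by lra.
  apply (derive_pos_increasing (fun z => - dPsi z)
           (fun z => - - / (z ^ 2 * (1 - z) ^ 2))); [exact Hxy| |].
  - intros z Hz. apply (is_derive_opp dPsi), is_derive_dPsi. lra.
  - intros z Hz. rewrite Ropp_involutive. apply Rinv_0_lt_compat, weight_pos. lra.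
Qed.

(** The factors 1 - 2 p and ln (p / (1 - p)) have opposite signs. With [Psi_ge_min] this bounds Psi
    along the contact points. *)
Lemma Psi_le_0 (p : R) : 0 < p < 1 -> Psi p <= 0.
Proof.
  intros Hp. unfold Psi.
  destruct (Rle_lt_dec p (1 / 2)) as [H|H].
  - assert (ln (p / (1 - p)) <= ln 1).
    { apply ln_le. apply Rdiv_lt_0_compat; lra.
      apply Rmult_le_reg_r with (1 - p); [lra|]. field_simplify; lra. }
    rewrite ln_1 in H0. nra.
  - assert (ln 1 <= ln (p / (1 - p))).
    { apply ln_le. lra.
      apply Rmult_le_reg_r with (1 - p); [lra|]. field_simplify; lra. }
    rewrite ln_1 in H0. nra.
Qed.

Lemma Psi_sym (p : R) : 0 < p < 1 -> Psi (1 - p) = Psi p.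
Proof.
  intros Hp. unfold Psi.
  replace ((1 - p) / (1 - (1 - p))) with (/ (p / (1 - p))) by (field; lra).
  rewrite ln_Rinv by (apply Rdiv_lt_0_compat; lra). ring.
Qed.

Lemma Psi_unbounded (M d : R) :
  0 < d -> exists x, 0 < x < d /\ x < 1 /\ Psi x < M.
Proof.
  intros Hd.
  (* with x = 1 / (1 + e^t) one has Psi x = - t (1 - 2 x) *)
  set (t := Rmax (/ d) (2 + 2 * Rabs M)).
  assert (Ht1 : / d <= t) by apply Rmax_l.
  assert (Ht2 : 2 + 2 * Rabs M <= t) by apply Rmax_r.
  assert (HM := Rle_abs (- M)). rewrite Rabs_Ropp in HM.
  assert (HM0 := Rabs_pos M).
  assert (He : 1 + t < exp t) by (apply exp_ineq1; lra).
  assert (Hx0 : 0 < / (1 + exp t)) by (apply Rinv_0_lt_compat; lra).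
  assert (Hxe : / (1 + exp t) * (1 + exp t) = 1) by (apply Rinv_l; lra).
  set (x := / (1 + exp t)) in *.
  (* Now 1 - 2 x > 1/2, so Psi x < - t / 2 <= - 1 - |M|; the other bound on t gives x < d. *)
  assert (Hx4 : 4 * x < 1) by nra.
  exists x. repeat split; try lra.
  - assert (Hdd : / d * d = 1) by (apply Rinv_l; lra).
    assert (x * / d < 1) by nra. nra.
  - unfold Psi.
    replace (x / (1 - x)) with (/ exp t).
    + rewrite ln_Rinv by apply exp_pos. rewrite ln_exp. nra.
    + unfold x. field. split; [lra|]. assert (H := exp_pos t). lra.
Qed.

(** * Double tangents of a convex-concave-convex function *)

(** The shape of H for one K, detached from g. Strict monotonicity of dh, unlike a sign of the
    second derivative, extends to the inflection points l and u themselves. *)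
Record convex_concave_convex (h dh : R -> R) (l u : R) : Prop := {
  ccc_l : 0 < l;
  ccc_lu : l < u;
  ccc_u : u < 1;
  ccc_derive : forall x, 0 < x < 1 -> is_derive h x (dh x);
  ccc_left : forall x y, 0 < x -> x < y -> y <= l -> dh x < dh y;
  ccc_mid : forall x y, l <= x -> x < y -> y <= u -> dh y < dh x;
  ccc_right : forall x y, u <= x -> x < y -> y < 1 -> dh x < dh y
}.

Definition double_tangent (h dh : R -> R) (l u A B : R) : Prop :=
  0 < A /\ A <= l /\ u <= B /\ B < 1 /\
  h B - h A = dh A * (B - A) /\ dh A = dh B.

Lemma tangent_lt_left (h dh : R -> R) (l u x y : R) :
  convex_concave_convex h dh l u ->
  0 < x -> x <= l -> 0 < y -> y <= l -> x <> y ->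
  h x + dh x * (y - x) < h y.
Proof.
  intros [Hl Hlu Hu Hd Hi _ _] Hx Hxl Hy Hyl Hne.
  assert (Hm : 0 < Rmin x y) by (apply Rmin_glb_lt; lra).
  assert (Hmx := Rmin_l x y). assert (Hmy := Rmin_r x y).
  apply (tangent_lt h dh (Rmin x y) l); try lra.
  - intros z Hz. apply Hd. lra.
  - intros z w Hz Hzw Hw. apply Hi; lra.
Qed.

Lemma tangent_lt_right (h dh : R -> R) (l u x y : R) :
  convex_concave_convex h dh l u ->
  u <= x -> x < 1 -> u <= y -> y < 1 -> x <> y ->
  h x + dh x * (y - x) < h y.
Proof.
  intros [Hl Hlu Hu Hd _ _ Hi] Hx Hxl Hy Hyl Hne.
  assert (Hm : Rmax x y < 1) by (apply Rmax_lub_lt; lra).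
  assert (Hmx := Rmax_l x y). assert (Hmy := Rmax_r x y).
  apply (tangent_lt h dh u (Rmax x y)); try lra.
  - intros z Hz. apply Hd. lra.
  - intros z w Hz Hzw Hw. apply Hi; lra.
Qed.

(** From l on, dh falls until u and then rises to at most dh B <= dh l, so it stays below dh l
    inside (l, B). This excludes a contact at l and gives the sign of the gap at the largest
    slope. *)
Lemma chord_slope_lt (h dh : R -> R) (l u B : R) :
  convex_concave_convex h dh l u -> u <= B -> B < 1 -> dh B <= dh l ->
  h B - h l < dh l * (B - l).
Proof.
  intros [Hl Hlu Hu Hd _ Hm Hi] HB HB1 Hle.
  destruct (mean_value h dh l B) as [c [Hc He]]; [lra|intros; apply Hd; lra|].
  enough (dh c < dh l) by nra.
  destruct (Rle_lt_dec c u) as [Hcu|Hcu].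
  - apply Hm; lra.
  - assert (dh c < dh B) by (apply Hi; lra). lra.
Qed.

Lemma chord_slope_gt (h dh : R -> R) (l u A : R) :
  convex_concave_convex h dh l u -> 0 < A -> A <= l -> dh u <= dh A ->
  dh u * (u - A) < h u - h A.
Proof.
  intros [Hl Hlu Hu Hd Hi Hm _] HA HA1 Hle.
  destruct (mean_value h dh A u) as [c [Hc He]]; [lra|intros; apply Hd; lra|].
  enough (dh u < dh c) by nra.
  destruct (Rle_lt_dec l c) as [Hcu|Hcu].
  - apply Hm; lra.
  - assert (dh A < dh c) by (apply Hi; lra). lra.
Qed.

(** A contact at an inflection point would contradict the strict chord inequalities. Strictness
    later makes H'' positive at both contact points. *)
Lemma double_tangent_strict (h dh : R -> R) (l u A B : R) :
  convex_concave_convex h dh l u -> double_tangent h dh l u A B ->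
  A < l /\ u < B.
Proof.
  intros Hc [HA [HAl [HuB [HB [He Hs]]]]].
  split.
  - destruct (Rle_lt_or_eq_dec A l HAl) as [H|H]; [exact H|exfalso]. subst A.
    assert (H := chord_slope_lt h dh l u B Hc HuB HB). lra.
  - destruct (Rle_lt_or_eq_dec u B HuB) as [H|H]; [exact H|exfalso]. subst B.
    assert (H := chord_slope_gt h dh l u A Hc HA HAl).
    rewrite He, Hs in H. lra.
Qed.

(** On each convex branch the line is a tangent. In between, h lies above its chord from l to u,
    whose ends already lie above the line. *)
Lemma double_tangent_below (h dh : R -> R) (l u A B : R) :
  convex_concave_convex h dh l u -> double_tangent h dh l u A B ->
  forall x, 0 < x < 1 -> h A + dh A * (x - A) <= h x.
Proof.
  intros Hc Ht.
  destruct (double_tangent_strict h dh l u A B Hc Ht) as [HAl' HuB'].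
  destruct Ht as [HA [HAl [HuB [HB [He Hs]]]]].
  assert (Hleft : forall x, 0 < x -> x <= l -> h A + dh A * (x - A) <= h x).
  { intros x Hx Hxl. destruct (Req_dec A x) as [->|Hne]; [lra|].
    left. apply (tangent_lt_left h dh l u); auto. }
  assert (Hright : forall x, u <= x -> x < 1 -> h A + dh A * (x - A) <= h x).
  { intros x Hx Hxl.
    replace (h A + dh A * (x - A)) with (h B + dh B * (x - B)) by (rewrite <- Hs; lra).
    destruct (Req_dec B x) as [->|Hne]; [lra|].
    left. apply (tangent_lt_right h dh l u); auto. }
  intros x Hx.
  destruct (Rle_lt_dec x l) as [Hxl|Hxl]; [apply Hleft; lra|].
  destruct (Rle_lt_dec u x) as [Hxu|Hxu]; [apply Hright; lra|].
  destruct Hc as [Hl Hlu Hu Hd _ Hm _].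
  assert (Hch : (u - x) * h l + (x - l) * h u < (u - l) * h x).
  { apply (chord_gt h dh l u); [| |lra].
    - intros z Hz. apply Hd. lra.
    - intros z w Hz Hzw Hw. apply Hm; lra. }
  assert (H1 : h A + dh A * (l - A) <= h l) by (apply Hleft; lra).
  assert (H2 : h A + dh A * (u - A) <= h u) by (apply Hright; lra).
  apply Rmult_le_reg_l with (u - l); [lra|].
  assert ((u - x) * (h A + dh A * (l - A)) <= (u - x) * h l)
    by (apply Rmult_le_compat_l; lra).
  assert ((x - l) * (h A + dh A * (u - A)) <= (x - l) * h u)
    by (apply Rmult_le_compat_l; lra).
  lra.
Qed.

Lemma intermediate_value (f : R -> R) (a b y : R) :
  a <= b -> (forall x, a <= x <= b -> continuous f x) -> f a <= y <= f b ->
  exists x, a <= x <= b /\ f x = y.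
Proof.
  intros Hab Hf Hy.
  destruct (Req_dec (f a) y) as [Ha|Ha]; [exists a; lra|].
  destruct (Req_dec (f b) y) as [Hb|Hb]; [exists b; lra|].
  destruct (Rle_lt_or_eq_dec a b Hab) as [Hlt| ->]; [|lra].
  destruct (IVT_interv (fun x => f x - y) a b) as [z [Hz He]]; try lra.
  - intros x Hx. apply continuity_pt_filterlim.
    apply (continuous_minus f (fun _ => y)); [now apply Hf|apply continuous_const].
  - exists z. split; [exact Hz|lra].
Qed.

Lemma lipschitz_continuous (f : R -> R) (x : R) :
  (forall y, Rabs (f y - f x) <= Rabs (y - x)) -> continuous f x.
Proof.
  intros Hf. apply filterlim_locally. intros eps. exists eps.
  intros y Hy. apply Rle_lt_trans with (2 := Hy). apply Hf.
Qed.

(** Makes the gap between tangents a function of every real slope, so that it is continuous from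
    both sides at the extreme slopes, as [intermediate_value] asks. *)
Definition clamp (a b s : R) : R := Rmax a (Rmin b s).

Lemma clamp_bounds (a b s : R) : a <= b -> a <= clamp a b s <= b.
Proof.
  intros Hab. unfold clamp, Rmax, Rmin.
  destruct (Rle_dec b s), (Rle_dec a _); lra.
Qed.

Lemma clamp_id (a b s : R) : a <= s <= b -> clamp a b s = s.
Proof.
  intros Hs. unfold clamp, Rmax, Rmin.
  destruct (Rle_dec b s), (Rle_dec a _); lra.
Qed.

Lemma clamp_lipschitz (a b s t : R) :
  a <= b -> Rabs (clamp a b s - clamp a b t) <= Rabs (s - t).
Proof.
  intros Hab. unfold clamp, Rmax, Rmin.
  destruct (Rle_dec b s), (Rle_dec b t); repeat destruct (Rle_dec a _);
    unfold Rabs; repeat destruct (Rcase_abs _); lra.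
Qed.

(* With [As s] and [Bs s] the points of slope [s] on the two convex branches, the
   vertical gap at the origin between the two tangents of slope [s] is 1-Lipschitz
   in [s] and changes sign between the slopes at the two inflection points. *)
Lemma double_tangent_exists (h dh : R -> R) (l u a b : R) :
  convex_concave_convex h dh l u ->
  (forall x, 0 < x < 1 -> continuous dh x) ->
  0 < a -> a < l -> dh a <= dh u -> u < b -> b < 1 -> dh l <= dh b ->
  exists A B, double_tangent h dh l u A B.
Proof.
  intros Hc Hcont Ha Hal Hau Hub Hb Hlb.
  assert (Hcc := Hc). destruct Hcc as [Hl Hlu Hu Hd Hi Hm Hi'].
  assert (Hul : dh u < dh l) by (apply Hm; lra).
  set (s1 := dh u) in *. set (s2 := dh l) in *.
  assert (HA : forall s, exists x, a <= x <= l /\ dh x = clamp s1 s2 s).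
  { intros s. assert (H := clamp_bounds s1 s2 s).
    apply intermediate_value; [lra| |fold s2; lra].
    intros x Hx. apply Hcont. lra. }
  assert (HB : forall s, exists x, u <= x <= b /\ dh x = clamp s1 s2 s).
  { intros s. assert (H := clamp_bounds s1 s2 s).
    apply intermediate_value; [lra| |fold s1; lra].
    intros x Hx. apply Hcont. lra. }
  set (As := fun s => proj1_sig (constructive_indefinite_description _ (HA s))).
  set (Bs := fun s => proj1_sig (constructive_indefinite_description _ (HB s))).
  assert (HAs : forall s, a <= As s <= l /\ dh (As s) = clamp s1 s2 s)
    by (intros s; exact (proj2_sig (constructive_indefinite_description _ (HA s)))).
  assert (HBs : forall s, u <= Bs s <= b /\ dh (Bs s) = clamp s1 s2 s)
    by (intros s; exact (proj2_sig (constructive_indefinite_description _ (HB s)))).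
  clearbody As Bs.
  set (F := fun s => (h (Bs s) - h (As s)) - clamp s1 s2 s * (Bs s - As s)).
  assert (HtA : forall s t, h (As s) + clamp s1 s2 s * (As t - As s) <= h (As t)).
  { intros s t. destruct (HAs s) as [Hs Es], (HAs t) as [Ht _]. rewrite <- Es.
    destruct (Req_dec (As s) (As t)) as [->|Hne]; [lra|].
    left. apply (tangent_lt_left h dh l u); auto; lra. }
  assert (HtB : forall s t, h (Bs s) + clamp s1 s2 s * (Bs t - Bs s) <= h (Bs t)).
  { intros s t. destruct (HBs s) as [Hs Es], (HBs t) as [Ht _]. rewrite <- Es.
    destruct (Req_dec (Bs s) (Bs t)) as [->|Hne]; [lra|].
    left. apply (tangent_lt_right h dh l u); auto; lra. }
  (* The tangent at [As s] tested at [As t] and the tangent at [Bs t] tested at [Bs s] bound the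
     increment of F by the slope change times [Bs s - As t], a length in (0,1). The choice functions
     themselves enter only through these inequalities. *)
  assert (Hlip : forall s t,
            F t - F s <= Rabs (clamp s1 s2 t - clamp s1 s2 s)).
  { intros s t. unfold F.
    assert (H1 := HtA s t). assert (H2 := HtB t s).
    destruct (HAs t) as [Ht _], (HBs s) as [Hs _].
    assert (F t - F s <= (clamp s1 s2 s - clamp s1 s2 t) * (Bs s - As t))
      by (unfold F; lra).
    rewrite Rabs_minus_sym.
    assert (H3 := Rle_abs (clamp s1 s2 s - clamp s1 s2 t)).
    assert (H4 := Rabs_pos (clamp s1 s2 s - clamp s1 s2 t)).
    unfold F in H. nra. }
  destruct (intermediate_value (fun s => - F s) s1 s2 0) as [s [Hs He]].
  - lra.
  - intros s _. apply lipschitz_continuous. intros t.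
    eapply Rle_trans; [|apply (clamp_lipschitz s1 s2); lra].
    assert (H1 := Hlip s t). assert (H2 := Hlip t s).
    rewrite Rabs_minus_sym in H2. apply Rabs_le. lra.
  (* At slope dh u the right tangency point is u, at slope dh l the left one is l; the chord lemmas
     then give F s1 > 0 > F s2. *)
  - assert (E1 := clamp_id s1 s2 s1). assert (E2 := clamp_id s1 s2 s2).
    destruct (HAs s1) as [HA1 EA1], (HBs s1) as [HB1 EB1].
    destruct (HAs s2) as [HA2 EA2], (HBs s2) as [HB2 EB2].
    unfold F. rewrite E1 in * by lra. rewrite E2 in * by lra.
    assert (EB : Bs s1 = u).
    { destruct (Req_dec (Bs s1) u) as [E|Hne]; [exact E|].
      assert (s1 < dh (Bs s1)) by (apply Hi'; lra). lra. }
    assert (EA : As s2 = l).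
    { destruct (Req_dec (As s2) l) as [E|Hne]; [exact E|].
      assert (dh (As s2) < s2) by (apply Hi; lra). lra. }
    rewrite EA, EB.
    assert (H1 := chord_slope_lt h dh l u (Bs s2) Hc).
    assert (H2 := chord_slope_gt h dh l u (As s1) Hc).
    fold s1 in H2. fold s2 in H1. lra.
  - exists (As s), (Bs s).
    destruct (HAs s) as [HA1 EA1], (HBs s) as [HB1 EB1].
    unfold F in He. repeat split; try lra. rewrite EA1. lra.
Qed.

(** * Derivatives of H and their link with A g *)

Definition dH (g : R -> R) (K p : R) : R := Derive g p - 2 * / K * dPsi p.

Definition ddH (g : R -> R) (K p : R) : R :=
  Derive_n g 2 p - 2 * / K * - / (p ^ 2 * (1 - p) ^ 2).

Lemma is_derive_H (g : R -> R) (K p : R) :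
  C2_open01 g -> 0 < p < 1 -> is_derive (H g K) p (dH g K p).
Proof.
  intros Hg Hp. destruct (Hg p Hp) as [H1 _]. unfold H, dH.
  apply (is_derive_minus g (fun x => 2 * / K * Psi x)).
  - now apply Derive_correct.
  - apply is_derive_scal, is_derive_Psi, Hp.
Qed.

Lemma is_derive_dH (g : R -> R) (K p : R) :
  C2_open01 g -> 0 < p < 1 -> is_derive (dH g K) p (ddH g K p).
Proof.
  intros Hg Hp. destruct (Hg p Hp) as [_ [H1 _]]. unfold dH, ddH.
  apply (is_derive_minus (Derive g) (fun x => 2 * / K * dPsi x)).
  - now apply Derive_correct.
  - apply is_derive_scal, is_derive_dPsi, Hp.
Qed.

Lemma ddH_opA (g : R -> R) (K p : R) :
  0 < p < 1 -> ddH g K p * (p ^ 2 * (1 - p) ^ 2) = 2 * (opA g p + / K).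
Proof.
  intros Hp. unfold ddH, opA. assert (Hw := weight_pos p Hp).
  assert (Hi : / (p ^ 2 * (1 - p) ^ 2) * (p ^ 2 * (1 - p) ^ 2) = 1)
    by (apply Rinv_l; lra).
  set (w := p ^ 2 * (1 - p) ^ 2) in *.
  replace (/ 2 * p ^ 2 * (1 - p) ^ 2 * Derive_n g 2 p)
    with (/ 2 * w * Derive_n g 2 p) by (unfold w; ring).
  transitivity (Derive_n g 2 p * w + 2 * / K * (/ w * w)); [ring|].
  rewrite Hi. lra.
Qed.

Lemma ddH_pos (g : R -> R) (K p : R) :
  0 < p < 1 -> - / K < opA g p -> 0 < ddH g K p.
Proof.
  intros Hp Ho. assert (Hw := weight_pos p Hp).
  assert (He := ddH_opA g K p Hp). nra.
Qed.

Lemma ddH_neg (g : R -> R) (K p : R) :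
  0 < p < 1 -> opA g p < - / K -> ddH g K p < 0.
Proof.
  intros Hp Ho. assert (Hw := weight_pos p Hp).
  assert (He := ddH_opA g K p Hp). nra.
Qed.

Lemma dH_increasing (g : R -> R) (K x y : R) :
  C2_open01 g -> 0 < x -> x < y -> y < 1 ->
  (forall z, x < z < y -> - / K < opA g z) -> dH g K x < dH g K y.
Proof.
  intros Hg Hx Hxy Hy Ho.
  apply (derive_pos_increasing _ (ddH g K)); [exact Hxy| |].
  - intros z Hz. apply is_derive_dH; [exact Hg|lra].
  - intros z Hz. apply ddH_pos; [lra|now apply Ho].
Qed.

Lemma dH_decreasing (g : R -> R) (K x y : R) :
  C2_open01 g -> 0 < x -> x < y -> y < 1 ->
  (forall z, x < z < y -> opA g z < - / K) -> dH g K y < dH g K x.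
Proof.
  intros Hg Hx Hxy Hy Ho.
  enough (- dH g K x < - dH g K y) by lra.
  apply (derive_pos_increasing (fun z => - dH g K z) (fun z => - ddH g K z));
    [exact Hxy| |].
  - intros z Hz. apply (is_derive_opp (dH g K)), is_derive_dH; [exact Hg|lra].
  - intros z Hz. assert (ddH g K z < 0) by (apply ddH_neg; [lra|now apply Ho]). lra.
Qed.

(** * Behaviour at the ends of (0,1) and sign of A g *)

Lemma concave_nonneg (g : R -> R) (p : R) : G1 g -> 0 <= p <= 1 -> 0 <= g p.
Proof.
  intros [_ [Hc [H0 H1]]] Hp.
  assert (H := Hc 0 1 (1 - p)). rewrite H0, H1 in H.
  replace ((1 - p) * 0 + (1 - (1 - p)) * 1) with p in H by ring.
  lra.
Qed.

(** Since g >= 0, H is at least - 2 / K times Psi, which exceeds M once Psi is below - M K / 2. *)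
Lemma H_unbounded_at_0 (g : R -> R) (K M d : R) :
  G1 g -> 0 < K -> 0 < d -> exists x, 0 < x < d /\ x < 1 /\ M < H g K x.
Proof.
  intros Hg HK Hd.
  destruct (Psi_unbounded (- (M * K / 2)) d Hd) as [x [Hx [Hx1 HP]]].
  exists x. repeat split; try lra. unfold H.
  assert (H0 := concave_nonneg g x Hg).
  assert (Hk : 0 < 2 * / K) by (apply Rdiv_lt_0_compat; lra).
  assert (2 * / K * Psi x < 2 * / K * - (M * K / 2))
    by (now apply Rmult_lt_compat_l).
  replace (2 * / K * - (M * K / 2)) with (- M) in H by (field; lra).
  lra.
Qed.

Lemma H_unbounded_at_1 (g : R -> R) (K M d : R) :
  G1 g -> 0 < K -> d < 1 -> exists x, d < x < 1 /\ 0 < x /\ M < H g K x.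
Proof.
  intros Hg HK Hd.
  destruct (Psi_unbounded (- (M * K / 2)) (1 - d)) as [x [Hx [Hx1 HP]]]; [lra|].
  exists (1 - x). repeat split; try lra. unfold H.
  rewrite Psi_sym by lra.
  assert (H0 := concave_nonneg g (1 - x) Hg).
  assert (Hk : 0 < 2 * / K) by (apply Rdiv_lt_0_compat; lra).
  assert (2 * / K * Psi x < 2 * / K * - (M * K / 2))
    by (now apply Rmult_lt_compat_l).
  replace (2 * / K * - (M * K / 2)) with (- M) in H by (field; lra).
  lra.
Qed.

Lemma H_tangent_gt (g : R -> R) (K a b x y : R) :
  C2_open01 g -> 0 < a -> b < 1 ->
  (forall z, a <= z <= b -> opA g z < - / K) ->
  a <= x <= b -> a <= y <= b -> x <> y ->
  H g K y < H g K x + dH g K x * (y - x).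
Proof.
  intros Hg Ha Hb Ho Hx Hy Hne.
  enough (- H g K x + - dH g K x * (y - x) < - H g K y) by lra.
  apply (tangent_lt (fun z => - H g K z) (fun z => - dH g K z) a b); auto.
  - intros z Hz. apply (is_derive_opp (H g K)), is_derive_H; [exact Hg|lra].
  - intros z w Hz Hzw Hw.
    enough (dH g K w < dH g K z) by lra.
    apply dH_decreasing; auto; try lra.
    intros v Hv. apply Ho. lra.
Qed.

(* Otherwise [g - c Psi] would be concave near 0, while it tends to infinity there. *)
Lemma opA_small_at_0 (g : R -> R) (c d : R) :
  G1 g -> 0 < c -> 0 < d -> exists x, 0 < x < d /\ x < 1 /\ - c < opA g x.
Proof.
  intros Hg Hc Hd. apply NNPP. intros Hn.
  set (m := Rmin d 1 / 2).
  assert (Hm : 0 < m /\ m < d /\ m < 1).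
  { unfold m, Rmin. destruct (Rle_dec d 1); lra. }
  (* With this K, - / K = - c / 2 lies strictly above - c, so a value of A g at most - c satisfies
     the strict inequality of [H_tangent_gt]. *)
  set (K := 2 / c).
  assert (HK : 0 < K) by (apply Rdiv_lt_0_compat; lra).
  assert (HKc : - c < - / K).
  { replace (/ K) with (c / 2) by (unfold K; field; lra). lra. }
  (* The chosen level bounds the tangent at m over (0, m), because |x - m| < 1 there. *)
  destruct (H_unbounded_at_0 g K (H g K m + Rabs (dH g K m)) m Hg HK)
    as [x [Hx [Hx1 HM]]]; [lra|].
  assert (Ht : H g K x < H g K m + dH g K m * (x - m)).
  { apply (H_tangent_gt g K x m); try lra; [apply Hg|].
    intros z Hz. apply Rle_lt_trans with (2 := HKc).
    destruct (Rle_lt_dec (opA g z) (- c)) as [H|H]; [exact H|].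
    elim Hn. exists z. lra. }
  assert (H1 := Rle_abs (- dH g K m)). rewrite Rabs_Ropp in H1.
  assert (H2 := Rabs_pos (dH g K m)).
  nra.
Qed.

Lemma opA_small_at_1 (g : R -> R) (c d : R) :
  G1 g -> 0 < c -> d < 1 -> exists x, d < x < 1 /\ 0 < x /\ - c < opA g x.
Proof.
  intros Hg Hc Hd. apply NNPP. intros Hn.
  set (m := (1 + Rmax d 0) / 2).
  assert (Hm : 0 < m /\ d < m /\ m < 1).
  { unfold m, Rmax. destruct (Rle_dec d 0); lra. }
  set (K := 2 / c).
  assert (HK : 0 < K) by (apply Rdiv_lt_0_compat; lra).
  assert (HKc : - c < - / K).
  { replace (/ K) with (c / 2) by (unfold K; field; lra). lra. }
  destruct (H_unbounded_at_1 g K (H g K m + Rabs (dH g K m)) m Hg HK)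
    as [x [Hx [Hx1 HM]]]; [lra|].
  assert (Ht : H g K x < H g K m + dH g K m * (x - m)).
  { apply (H_tangent_gt g K m x); try lra; [apply Hg|].
    intros z Hz. apply Rle_lt_trans with (2 := HKc).
    destruct (Rle_lt_dec (opA g z) (- c)) as [H|H]; [exact H|].
    elim Hn. exists z. lra. }
  assert (H1 := Rle_abs (dH g K m)).
  assert (H2 := Rabs_pos (dH g K m)).
  nra.
Qed.

Lemma continuous_opA (g : R -> R) (p : R) :
  C2_open01 g -> 0 < p < 1 -> continuous (opA g) p.
Proof.
  intros Hg Hp. destruct (Hg p Hp) as [_ [_ Hc]].
  apply (continuous_mult (fun x => / 2 * x ^ 2 * (1 - x) ^ 2) (Derive_n g 2));
    [|exact Hc].
  apply (ex_derive_continuous (fun x => / 2 * x ^ 2 * (1 - x) ^ 2)).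
  auto_derive. exact I.
Qed.

(** A positive second derivative at p stays positive nearby, so g lies strictly above its tangent at
    p on both sides; adding the two inequalities contradicts midpoint concavity. *)
Lemma concave_Derive2_le_0 (g : R -> R) (p : R) :
  G1 g -> 0 < p < 1 -> Derive_n g 2 p <= 0.
Proof.
  intros [Hg [Hc _]] Hp.
  destruct (Rle_lt_dec (Derive_n g 2 p) 0) as [H|H]; [exact H|exfalso].
  assert (Hl : locally p (fun x => 0 < x < 1 /\ 0 < Derive_n g 2 x)).
  { apply filter_and; [now apply locally_open01|].
    apply continuous_locally_gt; [now apply Hg|exact H]. }
  destruct Hl as [[d Hd] Hl].
  assert (Hin : forall x, p - d / 2 <= x <= p + d / 2 ->
                  0 < x < 1 /\ 0 < Derive_n g 2 x).
  { intros x Hx. apply Hl. change (Rabs (x - p) < d). apply Rabs_def1; lra. }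
  assert (Ht : forall y, p - d / 2 <= y <= p + d / 2 -> p <> y ->
                 g p + Derive g p * (y - p) < g y).
  { intros y. apply (tangent_lt g (Derive g) (p - d / 2) (p + d / 2)); try lra.
    - intros x Hx. apply Derive_correct, Hg, Hin, Hx.
    - intros x z Hx Hxz Hz.
      apply (derive_pos_increasing _ (Derive_n g 2)); [exact Hxz| |].
      + intros w Hw. apply Derive_correct, Hg, Hin. lra.
      + intros w Hw. apply Hin. lra. }
  assert (H1 := Ht (p - d / 2)). assert (H2 := Ht (p + d / 2)).
  destruct (Hin (p - d / 2)) as [I1 _]; [lra|].
  destruct (Hin (p + d / 2)) as [I2 _]; [lra|].
  assert (H3 := Hc (p - d / 2) (p + d / 2) (1 / 2)).
  replace (1 / 2 * (p - d / 2) + (1 - 1 / 2) * (p + d / 2)) with p in H3 by field.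
  lra.
Qed.

Lemma opA_le_0 (g : R -> R) (p : R) : G1 g -> 0 <= p <= 1 -> opA g p <= 0.
Proof.
  intros Hg Hp. unfold opA.
  destruct (Req_dec p 0) as [E|H0]; [rewrite E; lra|].
  destruct (Req_dec p 1) as [E|H1]; [rewrite E; lra|].
  assert (Hp' : 0 < p < 1) by lra.
  assert (Hw := weight_pos p Hp').
  assert (H2 := concave_Derive2_le_0 g p Hg Hp').
  nra.
Qed.

(** * The valley of A g, the constant beta and the inflection points *)

(** Unlike [G2], both branches include the bottom p0. *)
Definition valley (f : R -> R) (p0 : R) : Prop :=
  0 < p0 < 1 /\
  (forall x y, 0 < x -> x < y -> y <= p0 -> f y < f x) /\
  (forall x y, p0 <= x -> x < y -> y < 1 -> f x < f y).

Lemma continuous_le_of_near (f : R -> R) (p c : R) :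
  continuous f p -> (forall d, 0 < d -> exists x, Rabs (x - p) < d /\ f x <= c) ->
  f p <= c.
Proof.
  intros Hf Hn. destruct (Rle_lt_dec (f p) c) as [H|H]; [exact H|exfalso].
  destruct (continuous_locally_gt f p c Hf H) as [[d Hd] Hl].
  destruct (Hn d Hd) as [x [Hx Hc]]. specialize (Hl x Hx). lra.
Qed.

Lemma G2_valley (g : R -> R) : G1 g -> G2 g -> exists p0, valley (opA g) p0.
Proof.
  intros [Hg _] [p0 [Hp [Hd Hi]]]. exists p0. split; [exact Hp|].
  assert (Hc := continuous_opA g p0 Hg Hp).
  split.
  - intros x y Hx Hxy Hy.
    destruct (Rle_lt_or_eq_dec y p0 Hy) as [Hlt|E]; [now apply Hd|subst y].
    (* Passing to the limit at p0 yields only a weak inequality; the detour through the midpoint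
       keeps the conclusion strict. *)
    apply Rle_lt_trans with (opA g ((x + p0) / 2)); [|apply Hd; lra].
    apply continuous_le_of_near; [exact Hc|]. intros d Hd0.
    exists (Rmax ((x + 3 * p0) / 4) (p0 - d / 2)).
    assert (H1 := Rmax_l ((x + 3 * p0) / 4) (p0 - d / 2)).
    assert (H2 := Rmax_r ((x + 3 * p0) / 4) (p0 - d / 2)).
    assert (H3 : Rmax ((x + 3 * p0) / 4) (p0 - d / 2) < p0) by (apply Rmax_lub_lt; lra).
    split; [apply Rabs_def1; lra|]. left. apply Hd; lra.
  - intros x y Hx Hxy Hy.
    destruct (Rle_lt_or_eq_dec p0 x Hx) as [Hlt|E]; [now apply Hi|subst x].
    apply Rle_lt_trans with (opA g ((y + p0) / 2)); [|apply Hi; lra].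
    apply continuous_le_of_near; [exact Hc|]. intros d Hd0.
    exists (Rmin ((y + 3 * p0) / 4) (p0 + d / 2)).
    assert (H1 := Rmin_l ((y + 3 * p0) / 4) (p0 + d / 2)).
    assert (H2 := Rmin_r ((y + 3 * p0) / 4) (p0 + d / 2)).
    assert (H3 : p0 < Rmin ((y + 3 * p0) / 4) (p0 + d / 2)) by (apply Rmin_glb_lt; lra).
    split; [apply Rabs_def1; lra|]. left. apply Hi; lra.
Qed.

Lemma opA_bottom_neg (g : R -> R) (p0 : R) :
  G1 g -> valley (opA g) p0 -> opA g p0 < 0.
Proof.
  intros Hg [Hp [Hd _]].
  apply Rlt_le_trans with (opA g (p0 / 2)); [apply Hd; lra|].
  apply opA_le_0; [exact Hg|lra].
Qed.

(** A g is nonpositive, vanishes at 0 and 1, and is lowest at p0. Exhibiting this maximum is also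
    what gives the [epsilon] in [beta] its meaning. *)
Lemma beta_bottom (g : R -> R) (p0 : R) :
  G1 g -> valley (opA g) p0 -> beta g = - opA g p0.
Proof.
  intros Hg Hv. assert (Hneg := opA_bottom_neg g p0 Hg Hv).
  destruct Hv as [Hp [Hd Hi]].
  set (E := fun y => exists p, 0 <= p <= 1 /\ y = Rabs (opA g p)).
  assert (Hmax : is_max E (- opA g p0)).
  { split.
    - exists p0. split; [lra|]. now rewrite Rabs_left.
    - intros y [p [Hp01 ->]].
      rewrite Rabs_left1 by (now apply opA_le_0).
      apply Ropp_le_contravar.
      destruct (Req_dec p 0) as [E0|H0].
      { rewrite E0. unfold opA at 2. lra. }
      destruct (Req_dec p 1) as [E1|H1].
      { rewrite E1. unfold opA at 2. lra. }
      destruct (Rtotal_order p p0) as [H|[->|H]].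
      + left. apply Hd; lra.
      + lra.
      + left. apply Hi; lra. }
  assert (He : is_max E (beta g))
    by (apply (epsilon_spec (inhabits 0) (is_max E)); eauto).
  destruct Hmax as [M1 M2], He as [B1 B2].
  apply Rle_antisym; [now apply M2|now apply B2].
Qed.

Lemma beta_lt_inv (g : R -> R) (p0 K : R) :
  G1 g -> valley (opA g) p0 -> / beta g < K -> 0 < K /\ opA g p0 < - / K.
Proof.
  intros Hg Hv HK. assert (Hneg := opA_bottom_neg g p0 Hg Hv).
  rewrite (beta_bottom g p0 Hg Hv) in HK.
  assert (Hb : 0 < / - opA g p0) by (apply Rinv_0_lt_compat; lra).
  assert (H : / K < / / - opA g p0) by (apply Rinv_lt_contravar; nra).
  rewrite Rinv_inv in H. lra.
Qed.

Definition inflections (g : R -> R) (p0 K l u : R) : Prop :=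
  0 < l /\ l < p0 /\ p0 < u /\ u < 1 /\ opA g l = - / K /\ opA g u = - / K.

(** A g is below - 1 / K at p0 and above it somewhere near each end, so it crosses this level once
    on either branch. *)
Lemma inflections_exist (g : R -> R) (p0 K : R) :
  G1 g -> valley (opA g) p0 -> / beta g < K -> exists l u, inflections g p0 K l u.
Proof.
  intros Hg Hv HK. destruct (beta_lt_inv g p0 K Hg Hv HK) as [HK0 Hb].
  destruct Hv as [Hp _].
  assert (HKi : 0 < / K) by now apply Rinv_0_lt_compat.
  destruct (opA_small_at_0 g (/ K) p0 Hg HKi) as [x [Hx [_ Hox]]]; [lra|].
  destruct (opA_small_at_1 g (/ K) p0 Hg HKi) as [y [Hy [_ Hoy]]]; [lra|].
  assert (Hc : forall z, 0 < z < 1 -> continuous (opA g) z)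
    by (intros z; apply continuous_opA, Hg).
  destruct (intermediate_value (fun z => - opA g z) x p0 (/ K)) as [l [Hl El]];
    [lra| |lra|].
  { intros z Hz. apply (continuous_opp (opA g)), Hc. lra. }
  destruct (intermediate_value (opA g) p0 y (- / K)) as [u [Hu Eu]]; [lra| |lra|].
  { intros z Hz. apply Hc. lra. }
  exists l, u.
  assert (l <> p0) by (intros ->; lra). assert (u <> p0) by (intros ->; lra).
  unfold inflections. lra.
Qed.

Lemma inflections_ccc (g : R -> R) (p0 K l u : R) :
  G1 g -> valley (opA g) p0 -> inflections g p0 K l u ->
  convex_concave_convex (H g K) (dH g K) l u.
Proof.
  intros [Hg _] [Hp [Hd Hi]] [Hl [Hlp [Hpu [Hu [El Eu]]]]].
  split; try lra.
  - intros x Hx. now apply is_derive_H.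
  - intros x y Hx Hxy Hy. apply dH_increasing; auto; [lra|].
    intros z Hz. rewrite <- El. apply Hd; lra.
  - intros x y Hx Hxy Hy. apply dH_decreasing; auto; try lra.
    intros z Hz. destruct (Rle_lt_dec z p0).
    + rewrite <- El. apply Hd; lra.
    + rewrite <- Eu. apply Hi; lra.
  - intros x y Hx Hxy Hy. apply dH_increasing; auto; [lra|].
    intros z Hz. rewrite <- Eu. apply Hi; lra.
Qed.

Lemma sublevel_inflections (g : R -> R) (p0 K l u x : R) :
  valley (opA g) p0 -> inflections g p0 K l u -> (sublevel g K x <-> l < x < u).
Proof.
  intros [Hp [Hd Hi]] [Hl [Hlp [Hpu [Hu [El Eu]]]]]. split.
  - intros [Hx Ho]. split; apply Rnot_le_lt; intros Hle.
    + destruct (Req_dec x l) as [E|Hne]; [rewrite E in Ho; lra|].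
      assert (opA g l < opA g x) by (apply Hd; lra). lra.
    + destruct (Req_dec u x) as [E|Hne]; [rewrite <- E in Ho; lra|].
      assert (opA g u < opA g x) by (apply Hi; lra). lra.
  - intros Hx. split; [lra|]. destruct (Rle_lt_dec x p0).
    + rewrite <- El. apply Hd; lra.
    + rewrite <- Eu. apply Hi; lra.
Qed.

Lemma Glb_Rbar_open_interval (E : R -> Prop) (a b : R) :
  a < b -> (forall x, E x <-> a < x < b) -> Glb_Rbar E = a.
Proof.
  intros Hab HE. assert (Hm : E ((a + b) / 2)) by (apply HE; lra).
  apply is_glb_Rbar_unique. split.
  - intros x Hx. apply HE in Hx. simpl. lra.
  - intros [r| |] Hr; simpl; [|exact (Hr _ Hm)|exact I].
    apply Rnot_lt_le. intros Hlt.
    assert (H1 := Rmin_l r b). assert (H2 := Rmin_r r b).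
    assert (H3 : a < Rmin r b) by (apply Rmin_glb_lt; lra).
    assert (H4 : r <= (a + Rmin r b) / 2) by (apply Hr, HE; lra). lra.
Qed.

Lemma Lub_Rbar_open_interval (E : R -> Prop) (a b : R) :
  a < b -> (forall x, E x <-> a < x < b) -> Lub_Rbar E = b.
Proof.
  intros Hab HE. assert (Hm : E ((a + b) / 2)) by (apply HE; lra).
  apply is_lub_Rbar_unique. split.
  - intros x Hx. apply HE in Hx. simpl. lra.
  - intros [r| |] Hr; simpl; [|exact I|exact (Hr _ Hm)].
    apply Rnot_lt_le. intros Hlt.
    assert (H1 := Rmax_l r a). assert (H2 := Rmax_r r a).
    assert (H3 : Rmax r a < b) by (apply Rmax_lub_lt; lra).
    assert (H4 : (b + Rmax r a) / 2 <= r) by (apply Hr, HE; lra). lra.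
Qed.

Lemma tangency_pair_double_tangent (g : R -> R) (p0 K l u A B : R) :
  G1 g -> valley (opA g) p0 -> inflections g p0 K l u ->
  (tangency_pair g K (A, B) <-> double_tangent (H g K) (dH g K) l u A B).
Proof.
  intros [Hg _] Hv Hlu.
  assert (HD : forall x, 0 < x < 1 -> Derive (H g K) x = dH g K x)
    by (intros x Hx; now apply is_derive_unique, is_derive_H).
  unfold tangency_pair, pi_low, pi_up.
  rewrite (Glb_Rbar_open_interval _ l u), (Lub_Rbar_open_interval _ l u);
    try (intros x; exact (sublevel_inflections g p0 K l u x Hv Hlu));
    try (unfold inflections in Hlu; lra).
  simpl. unfold double_tangent. unfold inflections in Hlu. split.
  - intros [HA [HB [H1 [H2 [H3 H4]]]]]. rewrite !HD in * by assumption. intuition.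
  - intros [HA [H1 [H2 [HB [H3 H4]]]]]. rewrite !HD by lra. repeat split; lra.
Qed.

(** * Existence and uniqueness of the contact pair for each K *)

(** If dH stayed above dH u on (0, l), the mean value theorem would bound H from above there,
    against its blow-up at 0. The point a supplies the small slopes in [double_tangent_exists]. *)
Lemma steep_left_point (g : R -> R) (K l u : R) :
  G1 g -> 0 < K -> convex_concave_convex (H g K) (dH g K) l u ->
  exists a, 0 < a /\ a < l /\ dH g K a <= dH g K u.
Proof.
  intros Hg HK [Hl Hlu Hu Hd _ _ _]. apply NNPP. intros Hn.
  destruct (H_unbounded_at_0 g K (H g K l + Rabs (dH g K u)) l Hg HK Hl)
    as [x [Hx [_ HM]]].
  destruct (mean_value (H g K) (dH g K) x l) as [c [Hc He]]; [lra|intros; apply Hd; lra|].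
  assert (Hlt : dH g K u < dH g K c).
  { apply Rnot_le_lt. intros Hle. apply Hn. exists c. lra. }
  assert (H1 := Rle_abs (- dH g K u)). rewrite Rabs_Ropp in H1.
  assert (H2 := Rabs_pos (dH g K u)).
  nra.
Qed.

Lemma steep_right_point (g : R -> R) (K l u : R) :
  G1 g -> 0 < K -> convex_concave_convex (H g K) (dH g K) l u ->
  exists b, u < b /\ b < 1 /\ dH g K l <= dH g K b.
Proof.
  intros Hg HK [Hl Hlu Hu Hd _ _ _]. apply NNPP. intros Hn.
  destruct (H_unbounded_at_1 g K (H g K u + Rabs (dH g K l)) u Hg HK Hu)
    as [x [Hx [_ HM]]].
  destruct (mean_value (H g K) (dH g K) u x) as [c [Hc He]]; [lra|intros; apply Hd; lra|].
  assert (Hlt : dH g K c < dH g K l).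
  { apply Rnot_le_lt. intros Hle. apply Hn. exists c. lra. }
  assert (H1 := Rle_abs (dH g K l)).
  assert (H2 := Rabs_pos (dH g K l)).
  nra.
Qed.

(** Free of l and u, which depend on K, so that lines for different parameters can be compared
    directly. *)
Definition contact_line (g : R -> R) (K A B : R) : Prop :=
  0 < A < 1 /\ 0 < B < 1 /\
  H g K B - H g K A = dH g K A * (B - A) /\ dH g K A = dH g K B /\
  forall x, 0 < x < 1 -> H g K A + dH g K A * (x - A) <= H g K x.

Lemma double_tangent_contact_line (g : R -> R) (K l u A B : R) :
  convex_concave_convex (H g K) (dH g K) l u ->
  double_tangent (H g K) (dH g K) l u A B -> contact_line g K A B.
Proof.
  intros Hc Ht. assert (Hb := double_tangent_below _ _ _ _ _ _ Hc Ht).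
  destruct Ht as [HA [HAl [HuB [HB [He Hs]]]]], Hc as [Hl Hlu Hu _ _ _ _].
  repeat split; auto; lra.
Qed.

(* Compare each of the two supporting lines with the graph above it, at [A1] and [B2]. *)
Lemma slope_sandwich (g : R -> R) (K1 K2 A1 B1 A2 B2 : R) :
  contact_line g K1 A1 B1 -> contact_line g K2 A2 B2 ->
  (2 * / K1 - 2 * / K2) * (Psi B2 - Psi A1)
    <= (dH g K2 A2 - dH g K1 A1) * (B2 - A1).
Proof.
  intros [HA1 [HB1 [He1 [Hs1 Hb1]]]] [HA2 [HB2 [He2 [Hs2 Hb2]]]].
  assert (H1 := Hb1 B2 HB2). assert (H2 := Hb2 A1 HA1).
  unfold H in He2, H1, H2. lra.
Qed.

(** For equal parameters the left side of [slope_sandwich] vanishes; used in both orders, it forces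
    equal slopes, and dH is injective on each convex branch. *)
Lemma double_tangent_unique (g : R -> R) (K l u A1 B1 A2 B2 : R) :
  convex_concave_convex (H g K) (dH g K) l u ->
  double_tangent (H g K) (dH g K) l u A1 B1 ->
  double_tangent (H g K) (dH g K) l u A2 B2 -> A1 = A2 /\ B1 = B2.
Proof.
  intros Hc Ht1 Ht2.
  assert (H12 := slope_sandwich g K K A1 B1 A2 B2
    (double_tangent_contact_line _ _ _ _ _ _ Hc Ht1)
    (double_tangent_contact_line _ _ _ _ _ _ Hc Ht2)).
  assert (H21 := slope_sandwich g K K A2 B2 A1 B1
    (double_tangent_contact_line _ _ _ _ _ _ Hc Ht2)
    (double_tangent_contact_line _ _ _ _ _ _ Hc Ht1)).
  destruct Hc as [Hl Hlu Hu _ Hi _ Hi'].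
  destruct Ht1 as [HA1 [HAl1 [HuB1 [HB1 [_ Hs1]]]]].
  destruct Ht2 as [HA2 [HAl2 [HuB2 [HB2 [_ Hs2]]]]].
  assert (Hs : dH g K A1 = dH g K A2) by (apply Rle_antisym; nra).
  split.
  - destruct (Rtotal_order A1 A2) as [H|[H|H]]; [|exact H|].
    + assert (dH g K A1 < dH g K A2) by (apply Hi; lra). lra.
    + assert (dH g K A2 < dH g K A1) by (apply Hi; lra). lra.
  - destruct (Rtotal_order B1 B2) as [H|[H|H]]; [|exact H|].
    + assert (dH g K B1 < dH g K B2) by (apply Hi'; lra). lra.
    + assert (dH g K B2 < dH g K B1) by (apply Hi'; lra). lra.
Qed.

Lemma star_double_tangent (g : R -> R) (p0 K l u : R) :
  G1 g -> valley (opA g) p0 -> / beta g < K -> inflections g p0 K l u ->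
  double_tangent (H g K) (dH g K) l u (Astar g K) (Bstar g K).
Proof.
  intros Hg Hv HK Hlu.
  assert (Hc := inflections_ccc g p0 K l u Hg Hv Hlu).
  destruct (beta_lt_inv g p0 K Hg Hv HK) as [HK0 _].
  destruct (steep_left_point g K l u Hg HK0 Hc) as [a [Ha [Hal Hau]]].
  destruct (steep_right_point g K l u Hg HK0 Hc) as [b [Hb [Hbu Hlb]]].
  assert (Heq := fun A B => tangency_pair_double_tangent g p0 K l u A B Hg Hv Hlu).
  destruct (double_tangent_exists (H g K) (dH g K) l u a b) as [A [B Ht]]; auto.
  { intros x Hx. apply (ex_derive_continuous (dH g K)).
    eexists. apply is_derive_dH; [apply Hg|exact Hx]. }
  assert (Hu : unique (tangency_pair g K) (A, B)).
  { split; [now apply Heq|]. intros [A' B'] Ht'. apply Heq in Ht'.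
    destruct (double_tangent_unique g K l u A B A' B' Hc Ht Ht') as [-> ->].
    reflexivity. }
  (* A unique pair is now known to exist, so the [epsilon] in [ABstar] returns one satisfying its
     predicate. *)
  apply Heq. unfold Astar, Bstar. rewrite <- surjective_pairing.
  apply (epsilon_spec (inhabits (0, 0)) (unique (tangency_pair g K))).
  now exists (A, B).
Qed.

Lemma star_contact_line (g : R -> R) (p0 K : R) :
  G1 g -> valley (opA g) p0 -> / beta g < K ->
  contact_line g K (Astar g K) (Bstar g K).
Proof.
  intros Hg Hv HK. destruct (inflections_exist g p0 K Hg Hv HK) as [l [u Hlu]].
  apply double_tangent_contact_line with l u.
  - now apply inflections_ccc with p0.
  - now apply star_double_tangent with p0.
Qed.

Lemma star_bounds (g : R -> R) (p0 K : R) :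
  G1 g -> valley (opA g) p0 -> / beta g < K ->
  0 < Astar g K < p0 /\ p0 < Bstar g K < 1.
Proof.
  intros Hg Hv HK. destruct (inflections_exist g p0 K Hg Hv HK) as [l [u Hlu]].
  assert (Ht := star_double_tangent g p0 K l u Hg Hv HK Hlu).
  unfold double_tangent in Ht. unfold inflections in Hlu. lra.
Qed.

Lemma star_strict (g : R -> R) (p0 K l u : R) :
  G1 g -> valley (opA g) p0 -> / beta g < K -> inflections g p0 K l u ->
  Astar g K < l /\ u < Bstar g K.
Proof.
  intros Hg Hv HK Hlu. apply (double_tangent_strict (H g K) (dH g K)).
  - now apply inflections_ccc with p0.
  - now apply star_double_tangent with p0.
Qed.

Lemma star_ddH_pos (g : R -> R) (p0 K : R) :
  G1 g -> valley (opA g) p0 -> / beta g < K ->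
  0 < ddH g K (Astar g K) /\ 0 < ddH g K (Bstar g K).
Proof.
  intros Hg Hv HK. destruct (inflections_exist g p0 K Hg Hv HK) as [l [u Hlu]].
  assert (Hs := star_strict g p0 K l u Hg Hv HK Hlu).
  destruct (star_bounds g p0 K Hg Hv HK) as [HA HB].
  destruct Hv as [Hp [Hd Hi]], Hlu as [Hl [Hlp [Hpu [Hu [El Eu]]]]].
  split; (apply ddH_pos; [lra|]).
  - rewrite <- El. apply Hd; lra.
  - rewrite <- Eu. apply Hi; lra.
Qed.

(** * Monotonicity and continuity of the contact points in K *)

(** The condition on A g places x on the left convex branch, where dH is increasing. A fixed test
    point x thus converts continuity of the common slope into continuity of [Astar]. *)
Lemma Astar_compare (g : R -> R) (p0 K x : R) :
  G1 g -> valley (opA g) p0 -> / beta g < K ->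
  0 < x -> x <= p0 -> - / K < opA g x ->
  (x < Astar g K <-> dH g K x < dH g K (Astar g K)) /\
  (Astar g K < x <-> dH g K (Astar g K) < dH g K x).
Proof.
  intros Hg Hv HK Hx Hxp Ho.
  destruct (inflections_exist g p0 K Hg Hv HK) as [l [u Hlu]].
  destruct (inflections_ccc g p0 K l u Hg Hv Hlu) as [_ _ _ _ Hi _ _].
  assert (Ht := star_double_tangent g p0 K l u Hg Hv HK Hlu).
  unfold double_tangent in Ht.
  destruct Hv as [Hp [Hd _]], Hlu as [Hl [Hlp [_ [_ [El _]]]]].
  assert (Hxl : x <= l).
  { apply Rnot_lt_le. intros Hlt.
    assert (opA g x < opA g l) by (apply Hd; lra). lra. }
  assert (Hlt : x < Astar g K -> dH g K x < dH g K (Astar g K)) by (intros; apply Hi; lra).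
  assert (Hgt : Astar g K < x -> dH g K (Astar g K) < dH g K x) by (intros; apply Hi; lra).
  destruct (Rtotal_order x (Astar g K)) as [H|[H|H]].
  - specialize (Hlt H). lra.
  - rewrite <- H. lra.
  - specialize (Hgt H). lra.
Qed.

Lemma Bstar_compare (g : R -> R) (p0 K x : R) :
  G1 g -> valley (opA g) p0 -> / beta g < K ->
  p0 <= x -> x < 1 -> - / K < opA g x ->
  (x < Bstar g K <-> dH g K x < dH g K (Bstar g K)) /\
  (Bstar g K < x <-> dH g K (Bstar g K) < dH g K x).
Proof.
  intros Hg Hv HK Hx Hxp Ho.
  destruct (inflections_exist g p0 K Hg Hv HK) as [l [u Hlu]].
  destruct (inflections_ccc g p0 K l u Hg Hv Hlu) as [_ _ _ _ _ _ Hi].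
  assert (Ht := star_double_tangent g p0 K l u Hg Hv HK Hlu).
  unfold double_tangent in Ht.
  destruct Hv as [Hp [_ Hd]], Hlu as [_ [_ [Hpu [Hu [_ Eu]]]]].
  assert (Hxl : u <= x).
  { apply Rnot_lt_le. intros Hlt.
    assert (opA g x < opA g u) by (apply Hd; lra). lra. }
  assert (Hlt : x < Bstar g K -> dH g K x < dH g K (Bstar g K)) by (intros; apply Hi; lra).
  assert (Hgt : Bstar g K < x -> dH g K (Bstar g K) < dH g K x) by (intros; apply Hi; lra).
  destruct (Rtotal_order x (Bstar g K)) as [H|[H|H]].
  - specialize (Hlt H). lra.
  - rewrite <- H. lra.
  - specialize (Hgt H). lra.
Qed.

(* The difference of the two lines is affine, at most a positive multiple of the strictly
   concave [Psi] at [A1] and [B1], and at least that multiple at [y]. *)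
Lemma contact_not_inside (g : R -> R) (K1 K2 A1 B1 y s : R) :
  0 < K1 -> K1 < K2 -> contact_line g K1 A1 B1 ->
  (forall x, 0 < x < 1 -> H g K2 y + s * (x - y) <= H g K2 x) ->
  ~ (A1 < y < B1).
Proof.
  intros HK1 HK [HA1 [HB1 [He1 [Hs1 Hb1]]]] Hb2 Hy.
  assert (HA := Hb2 A1 HA1). assert (HB := Hb2 B1 HB1).
  assert (Hyy := Hb1 y ltac:(lra)).
  assert (He : 0 < 2 * / K1 - 2 * / K2).
  { assert (/ K2 < / K1) by (apply Rinv_lt_contravar; nra). lra. }
  assert (HE : forall x, H g K2 x = H g K1 x + (2 * / K1 - 2 * / K2) * Psi x)
    by (intros x; unfold H; ring).
  assert (Hch : (B1 - y) * Psi A1 + (y - A1) * Psi B1 < (B1 - A1) * Psi y).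
  { apply (chord_gt Psi dPsi); [| |exact Hy].
    - intros z Hz. apply is_derive_Psi. lra.
    - intros z w Hz Hzw Hw. apply dPsi_decreasing; lra. }
  rewrite !HE in HA, HB.
  set (e := 2 * / K1 - 2 * / K2) in *.
  assert (Hch' := Rmult_lt_compat_l e _ _ He Hch).
  assert (HA' := Rmult_le_compat_l (B1 - y) _ _ ltac:(lra) HA).
  assert (HB' := Rmult_le_compat_l (y - A1) _ _ ltac:(lra) HB).
  assert (Hy' := Rmult_le_compat_l (B1 - A1) _ _ ltac:(lra) Hyy).
  replace (H g K1 B1) with (H g K1 A1 + dH g K1 A1 * (B1 - A1)) in HB' by lra.
  lra.
Qed.

(** By [contact_not_inside] neither contact point for K2 lies strictly between those for K1, and p0
    separates left from right contact points. This confines the contact points for K <= K0 + 1 to a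
    compact subset of (0,1). *)
Lemma star_monotone (g : R -> R) (p0 K1 K2 : R) :
  G1 g -> valley (opA g) p0 -> / beta g < K1 -> K1 <= K2 ->
  Astar g K2 <= Astar g K1 /\ Bstar g K1 <= Bstar g K2.
Proof.
  intros Hg Hv HK1 [HK| ->]; [|lra].
  assert (HK2 : / beta g < K2) by lra.
  destruct (beta_lt_inv g p0 K1 Hg Hv HK1) as [HK0 _].
  assert (Hl1 := star_contact_line g p0 K1 Hg Hv HK1).
  assert (Hl2 := star_contact_line g p0 K2 Hg Hv HK2).
  assert (Hb1 := star_bounds g p0 K1 Hg Hv HK1).
  assert (Hb2 := star_bounds g p0 K2 Hg Hv HK2).
  destruct Hl2 as [_ [_ [He2 [Hs2 Hl2]]]].
  split; apply Rnot_lt_le; intros Hlt.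
  - apply (contact_not_inside g K1 K2 (Astar g K1) (Bstar g K1) (Astar g K2)
             (dH g K2 (Astar g K2)) HK0 HK Hl1 Hl2). lra.
  - apply (contact_not_inside g K1 K2 (Astar g K1) (Bstar g K1) (Bstar g K2)
             (dH g K2 (Astar g K2)) HK0 HK Hl1); [|lra].
    intros x Hx. specialize (Hl2 x Hx). lra.
Qed.

Lemma Psi_ge_min (a b x : R) :
  0 < a -> a <= x <= b -> b < 1 -> Rmin (Psi a) (Psi b) <= Psi x.
Proof.
  intros Ha Hx Hb.
  assert (H1 := Rmin_l (Psi a) (Psi b)). assert (H2 := Rmin_r (Psi a) (Psi b)).
  destruct (Req_dec a x) as [E|Hax]; [now rewrite <- E|].
  destruct (Req_dec x b) as [E|Hxb]; [now rewrite E|].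
  assert (Hch : (b - x) * Psi a + (x - a) * Psi b < (b - a) * Psi x).
  { apply (chord_gt Psi dPsi); [| |lra].
    - intros z Hz. apply is_derive_Psi. lra.
    - intros z w Hz Hzw Hw. apply dPsi_decreasing; lra. }
  set (m := Rmin (Psi a) (Psi b)) in *. nra.
Qed.

Lemma continuous_of_bound (f k : R -> R) (x C : R) :
  continuous k x -> locally x (fun y => Rabs (f y - f x) <= C * Rabs (k y - k x)) ->
  continuous f x.
Proof.
  intros Hk Hf. apply filterlim_locally. intros [e He].
  assert (HC := Rabs_pos C). assert (HC' := Rle_abs C).
  assert (He' : 0 < e / (Rabs C + 1)) by (apply Rdiv_lt_0_compat; lra).
  assert (Hk' := proj1 (filterlim_locally (F := locally x) k (k x)) Hk (mkposreal _ He')).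
  generalize (filter_and _ _ Hk' Hf). apply filter_imp. intros y [H1 H2].
  change (Rabs (f y - f x) < e). change (Rabs (k y - k x) < e / (Rabs C + 1)) in H1.
  apply Rle_lt_trans with (1 := H2).
  assert (H3 := Rabs_pos (k y - k x)).
  apply Rle_lt_trans with ((Rabs C + 1) * Rabs (k y - k x)); [nra|].
  replace e with ((Rabs C + 1) * (e / (Rabs C + 1))) by (field; lra).
  apply Rmult_lt_compat_l; lra.
Qed.

Lemma continuous_two_inv (K : R) : 0 < K -> continuous (fun K => 2 * / K) K.
Proof.
  intros HK. apply (ex_derive_continuous (fun K => 2 * / K)). auto_derive. lra.
Qed.

(** Divides a lower bound by a chord length D of which only D >= d is known; this can fail to be
    immediate only for negative x, and then x d >= x D. *)
Lemma slope_change_ge (x c d D m : R) :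
  0 < d -> d <= D -> 0 <= m -> - (c * m) <= x * D -> 0 <= c -> - (m / d * c) <= x.
Proof.
  intros Hd HD Hm H Hc.
  assert (0 <= c * m) by now apply Rmult_le_pos.
  apply Rmult_le_reg_r with d; [exact Hd|].
  replace (- (m / d * c) * d) with (- (c * m)) by (field; lra).
  destruct (Rle_lt_dec 0 x); nra.
Qed.

Lemma slope_continuous (g : R -> R) (p0 K0 : R) :
  G1 g -> valley (opA g) p0 -> / beta g < K0 ->
  continuous (fun K => dH g K (Astar g K)) K0.
Proof.
  intros Hg Hv HK0.
  destruct (beta_lt_inv g p0 K0 Hg Hv HK0) as [HK0' _].
  assert (Hb0 := star_bounds g p0 K0 Hg Hv HK0).
  assert (Hb1 := star_bounds g p0 (K0 + 1) Hg Hv ltac:(lra)).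
  assert (Hl0 := star_contact_line g p0 K0 Hg Hv HK0).
  set (A0 := Astar g K0) in *. set (B0 := Bstar g K0) in *.
  (* The mixed chords, from A0 to B and from A to B0, contain p0 and so have length at least d. *)
  set (d := Rmin (p0 - A0) (B0 - p0)).
  assert (Hd1 : d <= p0 - A0) by apply Rmin_l.
  assert (Hd2 : d <= B0 - p0) by apply Rmin_r.
  assert (Hd : 0 < d) by (apply Rmin_glb_lt; lra).
  (* All contact points for K <= K0 + 1 lie between those for K0 + 1, where the concave Psi is at
     least m; differences of its values are then at most - m in absolute value. *)
  set (m := Rmin (Psi (Astar g (K0 + 1))) (Psi (Bstar g (K0 + 1)))).
  assert (Hp : 0 < p0 < 1) by apply Hv.
  assert (HPsi : forall K, / beta g < K -> K <= K0 + 1 ->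
            (m <= Psi (Astar g K) <= 0) /\ (m <= Psi (Bstar g K) <= 0)).
  { intros K HK HK1. assert (Hb := star_bounds g p0 K Hg Hv HK).
    assert (Hm := star_monotone g p0 K (K0 + 1) Hg Hv HK HK1).
    split; (split; [apply Psi_ge_min|apply Psi_le_0]); lra. }
  assert (Hm0 := HPsi K0 HK0 ltac:(lra)). fold A0 B0 in Hm0.
  apply continuous_of_bound with (fun K => 2 * / K) (- m / d).
  { now apply continuous_two_inv. }
  fold A0.
  assert (Hloc : locally K0 (fun K => / beta g < K /\ K < K0 + 1)).
  { apply filter_and; [apply (open_gt (/ beta g) K0 HK0)|apply (open_lt (K0 + 1) K0); lra]. }
  revert Hloc. apply filter_imp. intros K [HK HK1].
  assert (Hb := star_bounds g p0 K Hg Hv HK).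
  assert (Hl := star_contact_line g p0 K Hg Hv HK).
  assert (Hm := HPsi K HK (Rlt_le _ _ HK1)).
  assert (S1 := slope_sandwich g K0 K _ _ _ _ Hl0 Hl).
  assert (S2 := slope_sandwich g K K0 _ _ _ _ Hl Hl0).
  set (A := Astar g K) in *. set (B := Bstar g K) in *.
  set (c := Rabs (2 * / K - 2 * / K0)).
  assert (Hc : 0 <= c) by apply Rabs_pos.
  assert (Hc1 := Rle_abs (2 * / K - 2 * / K0)). fold c in Hc1.
  assert (Hc2 := Rle_abs (- (2 * / K - 2 * / K0))). rewrite Rabs_Ropp in Hc2. fold c in Hc2.
  assert (Hprod : forall t z, - c <= t <= c -> m <= z <= - m -> - (c * - m) <= t * z).
  { intros t z Ht Hz. nra. }
  apply Rabs_le. split.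
  - apply slope_change_ge with (B - A0); try lra.
    eapply Rle_trans; [|exact S1]. apply Hprod; lra.
  - enough (- (- m / d * c) <= dH g K0 A0 - dH g K A) by lra.
    apply slope_change_ge with (B0 - A); try lra.
    eapply Rle_trans; [|exact S2]. apply Hprod; lra.
Qed.

Lemma continuous_dH_param (g : R -> R) (x K0 : R) :
  0 < K0 -> continuous (fun K => dH g K x) K0.
Proof.
  intros HK. unfold dH.
  apply (ex_derive_continuous (fun K => Derive g x - 2 * / K * dPsi x)).
  auto_derive. lra.
Qed.

Lemma locally_above_threshold (g : R -> R) (p0 K0 x : R) :
  G1 g -> valley (opA g) p0 -> / beta g < K0 -> - / K0 < opA g x ->
  locally K0 (fun K => / beta g < K /\ - / K < opA g x).
Proof.
  intros Hg Hv HK0 Ho. destruct (beta_lt_inv g p0 K0 Hg Hv HK0) as [HK0' _].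
  apply filter_and; [apply (open_gt (/ beta g) K0 HK0)|].
  apply (continuous_locally_lt (fun K => - / K)); [|exact Ho].
  apply (ex_derive_continuous (fun K => - / K)). auto_derive. lra.
Qed.

Lemma Astar_continuous (g : R -> R) (p0 K0 : R) :
  G1 g -> valley (opA g) p0 -> / beta g < K0 -> continuous (Astar g) K0.
Proof.
  intros Hg Hv HK0.
  destruct (beta_lt_inv g p0 K0 Hg Hv HK0) as [HK0' _].
  destruct (inflections_exist g p0 K0 Hg Hv HK0) as [l [u Hlu]].
  assert (Hs := star_strict g p0 K0 l u Hg Hv HK0 Hlu).
  assert (Hb := star_bounds g p0 K0 Hg Hv HK0).
  destruct Hlu as [_ [Hlp [_ [_ [El _]]]]].
  assert (Ho : forall x, 0 < x < l -> - / K0 < opA g x).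
  { intros x Hx. rewrite <- El. apply (proj1 (proj2 Hv)); lra. }
  assert (Hdiff : forall x, continuous (fun K => dH g K x - dH g K (Astar g K)) K0).
  { intros x. apply (continuous_minus (fun K => dH g K x) (fun K => dH g K (Astar g K))).
    - now apply continuous_dH_param.
    - now apply slope_continuous with p0. }
  apply continuous_of_locally_lt_gt; intros c Hc.
  (* Moving c up keeps the test point positive; in the other case the midpoint keeps it left of l,
     so A g x > - / K persists for K near K0. *)
  - set (x := Rmax c (Astar g K0 / 2)).
    assert (Hx1 : c <= x) by apply Rmax_l.
    assert (Hx2 : Astar g K0 / 2 <= x) by apply Rmax_r.
    assert (Hx3 : x < Astar g K0) by (apply Rmax_lub_lt; lra).
    assert (Hox : - / K0 < opA g x) by (apply Ho; lra).
    assert (Hd : dH g K0 x - dH g K0 (Astar g K0) < 0).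
    { assert (dH g K0 x < dH g K0 (Astar g K0)); [|lra].
      apply (Astar_compare g p0 K0 x); auto; lra. }
    generalize (filter_and (F := locally K0) _ _
      (locally_above_threshold g p0 K0 x Hg Hv HK0 Hox)
      (continuous_locally_lt _ _ _ (Hdiff x) Hd)).
    apply filter_imp. intros K [[HK HoK] HdK].
    apply Rle_lt_trans with (1 := Hx1).
    apply (Astar_compare g p0 K x); auto; lra.
  - set (x := Rmin c ((Astar g K0 + l) / 2)).
    assert (Hx1 : x <= c) by apply Rmin_l.
    assert (Hx2 : x <= (Astar g K0 + l) / 2) by apply Rmin_r.
    assert (Hx3 : Astar g K0 < x) by (apply Rmin_glb_lt; lra).
    assert (Hox : - / K0 < opA g x) by (apply Ho; lra).
    assert (Hd : 0 < dH g K0 x - dH g K0 (Astar g K0)).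
    { assert (dH g K0 (Astar g K0) < dH g K0 x); [|lra].
      apply (Astar_compare g p0 K0 x); auto; lra. }
    generalize (filter_and (F := locally K0) _ _
      (locally_above_threshold g p0 K0 x Hg Hv HK0 Hox)
      (continuous_locally_gt _ _ _ (Hdiff x) Hd)).
    apply filter_imp. intros K [[HK HoK] HdK].
    apply Rlt_le_trans with (2 := Hx1).
    apply (Astar_compare g p0 K x); auto; lra.
Qed.

Lemma star_slope_eq (g : R -> R) (p0 K : R) :
  G1 g -> valley (opA g) p0 -> / beta g < K ->
  dH g K (Bstar g K) = dH g K (Astar g K).
Proof.
  intros Hg Hv HK. symmetry. apply (star_contact_line g p0 K Hg Hv HK).
Qed.

Lemma Bstar_continuous (g : R -> R) (p0 K0 : R) :
  G1 g -> valley (opA g) p0 -> / beta g < K0 -> continuous (Bstar g) K0.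
Proof.
  intros Hg Hv HK0.
  destruct (beta_lt_inv g p0 K0 Hg Hv HK0) as [HK0' _].
  destruct (inflections_exist g p0 K0 Hg Hv HK0) as [l [u Hlu]].
  assert (Hs := star_strict g p0 K0 l u Hg Hv HK0 Hlu).
  assert (Hb := star_bounds g p0 K0 Hg Hv HK0).
  destruct Hlu as [_ [_ [Hpu [_ [_ Eu]]]]].
  assert (Ho : forall x, u < x < 1 -> - / K0 < opA g x).
  { intros x Hx. rewrite <- Eu. apply (proj2 (proj2 Hv)); lra. }
  assert (Hdiff : forall x, continuous (fun K => dH g K x - dH g K (Astar g K)) K0).
  { intros x. apply (continuous_minus (fun K => dH g K x) (fun K => dH g K (Astar g K))).
    - now apply continuous_dH_param.
    - now apply slope_continuous with p0. }
  assert (E0 := star_slope_eq g p0 K0 Hg Hv HK0).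
  apply continuous_of_locally_lt_gt; intros c Hc.
  - set (x := Rmax c ((Bstar g K0 + u) / 2)).
    assert (Hx1 : c <= x) by apply Rmax_l.
    assert (Hx2 : (Bstar g K0 + u) / 2 <= x) by apply Rmax_r.
    assert (Hx3 : x < Bstar g K0) by (apply Rmax_lub_lt; lra).
    assert (Hox : - / K0 < opA g x) by (apply Ho; lra).
    assert (Hd : dH g K0 x - dH g K0 (Astar g K0) < 0).
    { assert (dH g K0 x < dH g K0 (Bstar g K0)); [|lra].
      apply (Bstar_compare g p0 K0 x); auto; lra. }
    generalize (filter_and (F := locally K0) _ _
      (locally_above_threshold g p0 K0 x Hg Hv HK0 Hox)
      (continuous_locally_lt _ _ _ (Hdiff x) Hd)).
    apply filter_imp. intros K [[HK HoK] HdK].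
    apply Rle_lt_trans with (1 := Hx1).
    apply (Bstar_compare g p0 K x); auto; try lra.
    rewrite (star_slope_eq g p0 K Hg Hv HK). lra.
  - set (x := Rmin c ((Bstar g K0 + 1) / 2)).
    assert (Hx1 : x <= c) by apply Rmin_l.
    assert (Hx2 : x <= (Bstar g K0 + 1) / 2) by apply Rmin_r.
    assert (Hx3 : Bstar g K0 < x) by (apply Rmin_glb_lt; lra).
    assert (Hox : - / K0 < opA g x) by (apply Ho; lra).
    assert (Hd : 0 < dH g K0 x - dH g K0 (Astar g K0)).
    { assert (dH g K0 (Bstar g K0) < dH g K0 x); [|lra].
      apply (Bstar_compare g p0 K0 x); auto; lra. }
    generalize (filter_and (F := locally K0) _ _
      (locally_above_threshold g p0 K0 x Hg Hv HK0 Hox)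
      (continuous_locally_gt _ _ _ (Hdiff x) Hd)).
    apply filter_imp. intros K [[HK HoK] HdK].
    apply Rlt_le_trans with (2 := Hx1).
    apply (Bstar_compare g p0 K x); auto; try lra.
    rewrite (star_slope_eq g p0 K Hg Hv HK). lra.
Qed.

(** * Differentiability of the slope and of the contact points *)

(** A squeeze whose bounds may exchange roles: the sign of the increment of 2 / K decides which of
    them is the upper one. *)
Lemma continuous_between (r r1 r2 : R -> R) (x : R) :
  continuous r1 x -> continuous r2 x -> r1 x = r2 x ->
  locally x (fun y => Rmin (r1 y) (r2 y) <= r y <= Rmax (r1 y) (r2 y)) ->
  continuous r x.
Proof.
  intros H1 H2 E Hr.
  assert (Ex := locally_singleton _ _ Hr). simpl in Ex.
  rewrite <- E, Rmin_left, Rmax_left in Ex by apply Rle_refl.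
  assert (Er1 : r x = r1 x) by now apply Rle_antisym.
  assert (Er2 : r x = r2 x) by now rewrite Er1.
  apply continuous_of_locally_lt_gt; intros c Hc;
    assert (Hc1 := Hc); assert (Hc2 := Hc); rewrite Er1 in Hc1; rewrite Er2 in Hc2.
  - generalize (filter_and (F := locally x) _ _
      (filter_and (F := locally x) _ _
        (continuous_locally_gt r1 x c H1 Hc1)
        (continuous_locally_gt r2 x c H2 Hc2)) Hr).
    apply filter_imp. intros y [[Hy1 Hy2] Hy].
    apply Rlt_le_trans with (2 := proj1 Hy). now apply Rmin_glb_lt.
  - generalize (filter_and (F := locally x) _ _
      (filter_and (F := locally x) _ _
        (continuous_locally_lt r1 x c H1 Hc1)
        (continuous_locally_lt r2 x c H2 Hc2)) Hr).
    apply filter_imp. intros y [[Hy1 Hy2] Hy].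
    apply Rle_lt_trans with (1 := proj2 Hy). now apply Rmax_lub_lt.
Qed.

Lemma continuous_div (f h : R -> R) (x : R) :
  continuous f x -> continuous h x -> h x <> 0 -> continuous (fun y => f y / h y) x.
Proof.
  intros Hf Hh Hne. apply (continuous_mult f (fun y => / h y)); [exact Hf|].
  now apply continuous_Rinv_comp.
Qed.

Lemma continuous_Psi (p : R) : 0 < p < 1 -> continuous Psi p.
Proof.
  intros Hp. apply (ex_derive_continuous Psi). eexists. now apply is_derive_Psi.
Qed.

Lemma continuous_dPsi (p : R) : 0 < p < 1 -> continuous dPsi p.
Proof.
  intros Hp. apply (ex_derive_continuous dPsi). eexists. now apply is_derive_dPsi.
Qed.

(* Envelope theorem for the common slope, as a function of [2 / K]. *)
Lemma slope_quotient (g : R -> R) (p0 K0 : R) :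
  G1 g -> valley (opA g) p0 -> / beta g < K0 ->
  exists r : R -> R, continuous r K0 /\
    r K0 = (Psi (Astar g K0) - Psi (Bstar g K0)) / (Bstar g K0 - Astar g K0) /\
    locally K0 (fun K => dH g K (Astar g K) - dH g K0 (Astar g K0)
                         = r K * (2 * / K - 2 * / K0)).
Proof.
  intros Hg Hv HK0.
  destruct (beta_lt_inv g p0 K0 Hg Hv HK0) as [HK0' _].
  assert (Hb0 := star_bounds g p0 K0 Hg Hv HK0).
  assert (Hl0 := star_contact_line g p0 K0 Hg Hv HK0).
  assert (HcA := Astar_continuous g p0 K0 Hg Hv HK0).
  assert (HcB := Bstar_continuous g p0 K0 Hg Hv HK0).
  set (A0 := Astar g K0) in *. set (B0 := Bstar g K0) in *.
  assert (Hp : 0 < p0 < 1) by apply Hv.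
  set (r1 := fun K => (Psi A0 - Psi (Bstar g K)) / (Bstar g K - A0)).
  set (r2 := fun K => (Psi (Astar g K) - Psi B0) / (B0 - Astar g K)).
  (* The difference quotient of the slope in 2 / K, completed at increment 0 by [r1], which agrees
     with [r2] at K0. *)
  set (r := fun K => if Req_EM_T (2 * / K - 2 * / K0) 0 then r1 K
              else (dH g K (Astar g K) - dH g K0 A0) / (2 * / K - 2 * / K0)).
  assert (Hloc : locally K0 (fun K => / beta g < K)) by (apply (open_gt (/ beta g) K0 HK0)).
  assert (Hsand : forall K, / beta g < K ->
    (2 * / K - 2 * / K0) * r1 K <= dH g K (Astar g K) - dH g K0 A0
      <= (2 * / K - 2 * / K0) * r2 K).
  { intros K HK.
    destruct (beta_lt_inv g p0 K Hg Hv HK) as [HKpos _].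
    assert (Hb := star_bounds g p0 K Hg Hv HK).
    assert (Hl := star_contact_line g p0 K Hg Hv HK).
    assert (S1 := slope_sandwich g K0 K _ _ _ _ Hl0 Hl).
    assert (S2 := slope_sandwich g K K0 _ _ _ _ Hl Hl0).
    fold A0 in S1, S2. unfold r1, r2.
    split.
    - apply Rmult_le_reg_r with (Bstar g K - A0); [lra|].
      eapply Rle_trans; [|exact S1]. right. field. repeat split; lra.
    - apply Rmult_le_reg_r with (B0 - Astar g K); [lra|].
      apply Ropp_le_cancel.
      replace (- ((dH g K (Astar g K) - dH g K0 A0) * (B0 - Astar g K)))
        with ((dH g K0 A0 - dH g K (Astar g K)) * (B0 - Astar g K)) by ring.
      eapply Rle_trans; [|exact S2]. right. field. repeat split; lra. }
  exists r. split; [|split].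
  - apply continuous_between with r1 r2.
    + apply continuous_div; [| |fold B0; lra].
      * apply (continuous_minus (fun _ => Psi A0) (fun K => Psi (Bstar g K)));
          [apply continuous_const|].
        apply (continuous_comp (Bstar g) Psi); [exact HcB|]. apply continuous_Psi.
        fold B0. lra.
      * apply (continuous_minus (Bstar g) (fun _ => A0)); [exact HcB|apply continuous_const].
    + apply continuous_div; [| |fold A0; lra].
      * apply (continuous_minus (fun K => Psi (Astar g K)) (fun _ => Psi B0));
          [|apply continuous_const].
        apply (continuous_comp (Astar g) Psi); [exact HcA|]. apply continuous_Psi.
        fold A0. lra.
      * apply (continuous_minus (fun _ => B0) (Astar g)); [apply continuous_const|exact HcA].
    + reflexivity.
    + revert Hloc. apply filter_imp. intros K HK.
      destruct (Hsand K HK) as [S1 S2].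
      assert (M1 := Rmin_l (r1 K) (r2 K)). assert (M2 := Rmin_r (r1 K) (r2 K)).
      assert (M3 := Rmax_l (r1 K) (r2 K)). assert (M4 := Rmax_r (r1 K) (r2 K)).
      unfold r. destruct (Req_EM_T (2 * / K - 2 * / K0) 0) as [E|Hne]; [lra|].
      set (dk := 2 * / K - 2 * / K0) in *.
      set (ds := dH g K (Astar g K) - dH g K0 A0) in *.
      assert (Eq : ds = dk * (ds / dk)) by (field; exact Hne).
      rewrite Eq in S1, S2.
      destruct (Rdichotomy _ _ Hne) as [Hneg|Hpos].
      * assert (r2 K <= ds / dk) by nra. assert (ds / dk <= r1 K) by nra. lra.
      * apply Rmult_le_reg_l in S1; [|exact Hpos].
        apply Rmult_le_reg_l in S2; [|exact Hpos]. lra.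
  - unfold r. destruct (Req_EM_T (2 * / K0 - 2 * / K0) 0) as [_|Hne]; [reflexivity|].
    elim Hne. ring.
  - revert Hloc. apply filter_imp. intros K HK.
    destruct (Hsand K HK) as [S1 S2].
    unfold r. destruct (Req_EM_T (2 * / K - 2 * / K0) 0) as [E|Hne].
    + rewrite E in S1, S2. rewrite E. lra.
    + unfold Rdiv. rewrite Rmult_assoc, Rinv_l, Rmult_1_r by exact Hne. reflexivity.
Qed.

(** X stands for [Astar] or [Bstar]. Factoring the increment of dH at the fixed parameter K0 makes
    the slope equation linear in X K - X K0, with a coefficient q that is nonzero near K0 because
    H'' is nonzero at X K0. *)
Lemma contact_is_derive (g X : R -> R) (p0 K0 : R) :
  G1 g -> valley (opA g) p0 -> / beta g < K0 ->
  continuous X K0 -> 0 < X K0 < 1 -> ddH g K0 (X K0) <> 0 ->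
  (forall K, / beta g < K -> dH g K (X K) = dH g K (Astar g K)) ->
  is_derive X K0
    (2 / K0 ^ 2 *
     ((Psi (Bstar g K0) - Psi (Astar g K0) - dPsi (X K0) * (Bstar g K0 - Astar g K0)) /
      (ddH g K0 (X K0) * (Bstar g K0 - Astar g K0)))).
Proof.
  intros Hg Hv HK0 HcX HX Hne Heq.
  destruct (beta_lt_inv g p0 K0 Hg Hv HK0) as [HK0' _].
  assert (Hb0 := star_bounds g p0 K0 Hg Hv HK0).
  destruct (slope_quotient g p0 K0 Hg Hv HK0) as [r [Hrc [Er Hr]]].
  destruct (is_derive_slope (dH g K0) (X K0) (ddH g K0 (X K0))) as [q [Hqc [Eq Hq]]].
  { apply is_derive_dH; [apply Hg|exact HX]. }
  assert (HqX : continuous (fun K => q (X K)) K0) by (now apply (continuous_comp X q)).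
  (* The last factor is the difference quotient of 2 / K between K and K0. *)
  set (w := fun K => (r K + dPsi (X K)) / q (X K) * (- (2 / (K * K0)))).
  match goal with |- is_derive _ _ ?l => replace l with (w K0) end.
  2: { unfold w. rewrite Er, Eq. field. repeat split; lra. }
  apply slope_is_derive.
  - apply (continuous_mult (fun K => (r K + dPsi (X K)) / q (X K))
             (fun K => - (2 / (K * K0)))).
    + apply continuous_div; [|exact HqX|now rewrite Eq].
      apply (continuous_plus r (fun K => dPsi (X K))); [exact Hrc|].
      apply (continuous_comp X dPsi); [exact HcX|now apply continuous_dPsi].
    + apply (ex_derive_continuous (fun K => - (2 / (K * K0)))). auto_derive. nra.
  - assert (Hloc : locally K0 (fun K => / beta g < K)) by (apply (open_gt (/ beta g) K0 HK0)).
    assert (Hqne : locally K0 (fun K => q (X K) <> 0)).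
    { rewrite <- Eq in Hne. exact (HqX (fun z => z <> 0) (open_neq 0 _ Hne)). }
    generalize (filter_and _ _ Hloc (filter_and _ _ Hqne Hr)).
    apply filter_imp. intros K [HK [HqK HrK]].
    destruct (beta_lt_inv g p0 K Hg Hv HK) as [HKpos _].
    assert (E : q (X K) * (X K - X K0) = (r K + dPsi (X K)) * (2 * / K - 2 * / K0)).
    { rewrite <- Hq.
      rewrite <- (Heq K HK), <- (Heq K0 HK0) in HrK.
      assert (dH g K0 (X K) = dH g K (X K) + (2 * / K - 2 * / K0) * dPsi (X K))
        by (unfold dH; ring).
      lra. }
    apply Rmult_eq_reg_l with (q (X K)); [|exact HqK].
    rewrite E. unfold w. field. repeat split; lra.
Qed.

Lemma contact_derivative_continuous (g X : R -> R) (p0 K0 : R) :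
  G1 g -> valley (opA g) p0 -> / beta g < K0 ->
  continuous X K0 -> 0 < X K0 < 1 -> ddH g K0 (X K0) <> 0 ->
  continuous (fun K =>
    2 / K ^ 2 *
     ((Psi (Bstar g K) - Psi (Astar g K) - dPsi (X K) * (Bstar g K - Astar g K)) /
      (ddH g K (X K) * (Bstar g K - Astar g K)))) K0.
Proof.
  intros Hg Hv HK0 HcX HX Hne.
  destruct (beta_lt_inv g p0 K0 Hg Hv HK0) as [HK0' _].
  assert (Hb0 := star_bounds g p0 K0 Hg Hv HK0).
  assert (HcA := Astar_continuous g p0 K0 Hg Hv HK0).
  assert (HcB := Bstar_continuous g p0 K0 Hg Hv HK0).
  assert (HAB : continuous (fun K => Bstar g K - Astar g K) K0)
    by (now apply (continuous_minus (Bstar g) (Astar g))).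
  apply (continuous_mult (fun K => 2 / K ^ 2)).
  - apply (ex_derive_continuous (fun K => 2 / K ^ 2)). auto_derive. nra.
  - apply continuous_div.
    + apply (continuous_minus (fun K => Psi (Bstar g K) - Psi (Astar g K))
               (fun K => dPsi (X K) * (Bstar g K - Astar g K))).
      * apply (continuous_minus (fun K => Psi (Bstar g K)) (fun K => Psi (Astar g K))).
        -- apply (continuous_comp (Bstar g) Psi); [exact HcB|apply continuous_Psi; lra].
        -- apply (continuous_comp (Astar g) Psi); [exact HcA|apply continuous_Psi].
           destruct Hv. lra.
      * apply (continuous_mult (fun K => dPsi (X K))); [|exact HAB].
        apply (continuous_comp X dPsi); [exact HcX|now apply continuous_dPsi].
    + apply (continuous_mult (fun K => ddH g K (X K))); [|exact HAB].
      apply (continuous_minus (fun K => Derive_n g 2 (X K))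
               (fun K => 2 * / K * - / (X K ^ 2 * (1 - X K) ^ 2))).
      * apply (continuous_comp X (Derive_n g 2)); [exact HcX|]. now apply Hg.
      * apply (continuous_mult (fun K => 2 * / K)); [now apply continuous_two_inv|].
        apply (continuous_comp X (fun x => - / (x ^ 2 * (1 - x) ^ 2))); [exact HcX|].
        apply (ex_derive_continuous (fun x => - / (x ^ 2 * (1 - x) ^ 2))).
        auto_derive. assert (Hw := weight_pos _ HX). simpl in Hw. lra.
    + apply Rmult_integral_contrapositive. split; [exact Hne|lra].
Qed.

(** The derivative formula holds at every K above the threshold, so near K0 [Derive X] coincides
    with an expression already known to be continuous. *)
Lemma contact_C1 (g X : R -> R) (p0 K0 : R) :
  G1 g -> valley (opA g) p0 -> / beta g < K0 ->
  (forall K, / beta g < K ->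
     continuous X K /\ 0 < X K < 1 /\ 0 < ddH g K (X K) /\
     dH g K (X K) = dH g K (Astar g K)) ->
  is_derive X K0
    (2 / K0 ^ 2 *
     ((Psi (Bstar g K0) - Psi (Astar g K0)
       - Derive Psi (X K0) * (Bstar g K0 - Astar g K0)) /
      ((Derive_n g 2 (X K0) - 2 * / K0 * Derive_n Psi 2 (X K0))
       * (Bstar g K0 - Astar g K0)))) /\
  continuous (Derive X) K0.
Proof.
  intros Hg Hv HK0 HX.
  assert (HD : forall K, / beta g < K -> is_derive X K
    (2 / K ^ 2 *
     ((Psi (Bstar g K) - Psi (Astar g K) - dPsi (X K) * (Bstar g K - Astar g K)) /
      (ddH g K (X K) * (Bstar g K - Astar g K))))).
  { intros K HK. destruct (HX K HK) as [H1 [H2 [H3 _]]].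
    apply contact_is_derive with p0; auto.
    - lra.
    - intros K' HK'. now apply HX. }
  destruct (HX K0 HK0) as [H1 [H2 [H3 _]]].
  split.
  - rewrite Derive_Psi, Derive2_Psi by exact H2. now apply HD.
  - eapply continuous_ext_loc; [|apply (contact_derivative_continuous g X p0 K0); auto; lra].
    assert (Hloc : locally K0 (fun K => / beta g < K)) by (apply (open_gt (/ beta g) K0 HK0)).
    revert Hloc. apply filter_imp. intros K HK.
    symmetry. now apply is_derive_unique, HD.
Qed.

Theorem proposition4p1 (g : R -> R) (hG1 : G1 g) (hG2 : G2 g) :
  forall K : R, / beta g < K ->
    (is_derive (Astar g) K
       (2 / K ^ 2 *
        ((Psi (Bstar g K) - Psi (Astar g K)
          - Derive Psi (Astar g K) * (Bstar g K - Astar g K)) /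
         ((Derive_n g 2 (Astar g K) - 2 * / K * Derive_n Psi 2 (Astar g K))
          * (Bstar g K - Astar g K)))) /\
     continuous (Derive (Astar g)) K) /\
    (is_derive (Bstar g) K
       (2 / K ^ 2 *
        ((Psi (Bstar g K) - Psi (Astar g K)
          - Derive Psi (Bstar g K) * (Bstar g K - Astar g K)) /
         ((Derive_n g 2 (Bstar g K) - 2 * / K * Derive_n Psi 2 (Bstar g K))
          * (Bstar g K - Astar g K)))) /\
     continuous (Derive (Bstar g)) K).
Proof.
  intros K HK.
  destruct (G2_valley g hG1 hG2) as [p0 Hv].
  assert (Hp : 0 < p0 < 1) by apply Hv.
  split; apply contact_C1 with p0; auto; intros K' HK';
    destruct (star_bounds g p0 K' hG1 Hv HK') as [HA HB];
    destruct (star_ddH_pos g p0 K' hG1 Hv HK') as [HdA HdB].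
  - repeat split; auto; try lra. now apply Astar_continuous with p0.
  - repeat split; auto; try lra.
    + now apply Bstar_continuous with p0.
    + now apply star_slope_eq with p0.
Qed.
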